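(* The monoid $\mathrm{Emb}(\mathbb{Q},sep)$ has automatic homeomorphicity: for every countable set $\Omega$ and every monoid isomorphism $\theta$ from $\mathrm{Emb}(\mathbb{Q},sep)$ onto a closed submonoid of $Tr(\Omega)$, $\theta$ is a homeomorphism.
   Context: On $\mathbb{Q}$ let $circ(x,y,z)$ iff $x\le y\le z$ or $y\le z\le x$ or $z\le x\le y$, and let the separation relation be $sep(x,y,z,t)$ iff ($circ(x,y,z)\wedge circ(x,t,y)$) or ($circ(x,z,y)\wedge circ(x,y,t)$). $\mathrm{Emb}(\mathbb{Q},sep)$ is the monoid of injective maps $f:\mathbb{Q}\to\mathbb{Q}$ preserving $sep$ (equivalently, injective maps preserving the corresponding strict separation relation). For a countable set $X$, $Tr(X)$ is the monoid of all maps $X\to X$. Transformation monoids carry the topology of pointwise convergence, whose basic open sets are $\{f : f(b_k)=c_k \text{ for } k=1,\dots,n\}$ for finite tuples of points. *)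

(* Defs.v *)
From HB Require Import structures.
From mathcomp Require Import all_boot all_order all_algebra.
From mathcomp Require Import all_classical topology.

Set Implicit Arguments.
Unset Strict Implicit.
Unset Printing Implicit Defensive.

Import Order.TTheory GRing.Theory Num.Theory.
Local Open Scope classical_set_scope.
Local Open Scope ring_scope.

(* Only the copy of X used as codomain is given the discrete topology: the
   product topology is then that of pointwise convergence, see [open_TrP]. *)
Definition Tr (X : choiceType) : Type := {ptws X -> discrete_topology X}.

HB.instance Definition _ (X : choiceType) := Topological.on (Tr X).

Lemma open_TrP (X : choiceType) (U : set (Tr X)) :
  open U <-> forall f, U f ->
    exists b : seq X, [set g : Tr X | {in b, g =1 f}] `<=` U.
Proof.
pose cyl (f : Tr X) (b : seq X) := [set g : Tr X | {in b, g =1 f}].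
have cyl_nbhs f b : nbhs f (cyl f b).
  elim: b => [|x b IHb].
    by apply: filterS (@filterT _ (nbhs f) _) => g _ x; rewrite in_nil.
  have fx : nbhs f [set g : Tr X | g x = f x].
    have := @proj_continuous X (fun=> discrete_topology X) x f [set f x].
    by apply; exact: (@discrete_set1 (discrete_topology X)).
  apply: filterS (filterI fx IHb) => g [gx gb] y.
  by rewrite in_cons => /predU1P[->|/gb].
split=> [Uo f Uf|UP]; last first.
  by rewrite openE => f /UP[b bU]; exact: filterS bU (cyl_nbhs f b).
pose F : set_system (Tr X) := [set V | exists b, cyl f b `<=` V].
have FF : Filter F.
  split; first by exists [::].
    move=> V W [b bV] [c cW]; exists (b ++ c) => g gbc.
    by split; [apply: bV|apply: cW] => x xb; apply: gbc;
      rewrite mem_cat xb ?orbT.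
  by move=> V W VW [b bV]; exists b => g /bV/VW.
suff : F --> f by apply; exact: open_nbhs_nbhs.
apply/cvg_sup => x V; rewrite nbhsE => -[_ [[A Ao <-] Af] AV].
exists [:: x] => g gx; apply: AV => /=.
by rewrite gx ?mem_head.
Qed.

Definition Tr_one (X : choiceType) : Tr X := fun x => x.

Definition Tr_mul (X : choiceType) (f g : Tr X) : Tr X := fun x => f (g x).

Fact Tr_mulA (X : choiceType) : associative (@Tr_mul X).
Proof. by []. Qed.

Fact Tr_1mul (X : choiceType) : left_id (@Tr_one X) (@Tr_mul X).
Proof. by []. Qed.

Fact Tr_mul1 (X : choiceType) : right_id (@Tr_one X) (@Tr_mul X).
Proof. by []. Qed.

HB.instance Definition _ (X : choiceType) :=
  isMonoid.Build (Tr X) (@Tr_mulA X) (@Tr_1mul X) (@Tr_mul1 X).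

Definition circ (x y z : rat) : bool :=
  [|| x <= y <= z, y <= z <= x | z <= x <= y].

Definition sep (x y z t : rat) : bool :=
  circ x y z && circ x t y || circ x z y && circ x y t.

Definition sep_embedding : set (Tr rat) :=
  [set f | injective f /\
     forall x y z t, sep x y z t -> sep (f x) (f y) (f z) (f t)].

Fact sep_embedding_closed : monoid_closed [in sep_embedding].
Proof.
split=> [|f g]; first by rewrite !inE; split.
rewrite !inE => -[fI fS] [gI gS].
by split=> [x y /fI/gI|x y z t /gS/fS].
Qed.

Definition Emb_Q_sep : Type := set_type sep_embedding.

HB.instance Definition _ := Topological.on Emb_Q_sep.
HB.instance Definition _ := SubType.on Emb_Q_sep.
HB.instance Definition _ :=
  SubChoice_isSubMonoid.Build _ _ Emb_Q_sep sep_embedding_closed.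

Definition homeomorphism (X Y : topologicalType) (f : X -> Y) : Prop :=
  continuous f /\ exists g : Y -> X, [/\ cancel f g, cancel g f & continuous g].

(* Main.v *)
(* Let [G] be the group of invertible elements of the monoid [E] and let [E] act
   on [Omega] through [theta].

   Continuity on [G]: the stabilizer of a point of [Omega] induces on the
   automorphisms of a linear order cut out of the circle a subgroup [K] of
   countable index.  Such a [K] contains the pointwise stabilizer of a finite
   set: [K] is dense in one by a Baire argument, and diagonalising against the
   cosets of [K] along sequences of disjoint intervals, combined with
   commutators, shows that [K] contains all automorphisms supported near any
   cut.

   Continuity on [E]: [G] is dense in [E], so the action of [G] extends by
   continuity to an action of [E], which, [M] being closed, is [theta \o xi] for
   an endomorphism [xi] of [E] fixing [G].  Composing with an embedding whose
   image has a gap next to a given point shows that [xi] is the identity.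

   Continuity of the inverse: if [F] is a smallest support of a point [w] moved
   by an orientation preserving automorphism, the stabilizer of [w] preserves
   [F]; two such supports meeting in one point determine the value there. *)
Require Import Defs.
From mathcomp Require Import all_boot all_order all_algebra.
From mathcomp Require Import all_classical topology.
From mathcomp Require Import lra zify.

Local Open Scope classical_set_scope.

(* [GRing.Theory] is imported in this section only: it shadows the
   [monoid_morphism] of the theorem. *)
Section Development.

Set Implicit Arguments.
Unset Strict Implicit.
Unset Printing Implicit Defensive.

Import Order.TTheory GRing.Theory Num.Theory.

Local Open Scope ring_scope.

(** Countability of [Omega] enters as countable index of the point stabilizers. The group [G] fixes
    no point of the circle and contains reflections, so intervals are handled in the linear order
    left after removing [0], and translations, which act transitively, carry the results to the
    other points. A subgroup [K] of countable index cannot be treated one interval at a time: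
    nothing makes it closed under infinite products, and density yields agreement on finite sets
    only. Hence the sequences of blocks, on which a single diagonalisation controls infinitely many
    intervals at once. For the inverse, a point of [Omega] may code an unordered finite set, so that
    its stabilizer fixes no rational and a single point of [Omega] does not recover a value of [f];
    a point sensitive to the orientation alone gives no information on values at all. This is the
    reason for moved points and for pairs of supports. *)

(** * Countable dense linear orders and back and forth *)

Record dense_order (T : eqType) (lt : rel T) : Prop := DenseOrder {
  lt_irr : irreflexive lt;
  lt_tr : transitive lt;
  lt_tot : forall x y, x != y -> lt x y || lt y x;
  lt_dense : forall x y, lt x y -> exists2 z, lt x z & lt z y;
  lt_nomin : forall x, exists y, lt y x;
  lt_nomax : forall x, exists y, lt x y;
  lt_inhab : exists x : T, True }.

(** Agreement of the strict comparisons suffices: between total orders it already makes the list a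
    functional and injective relation. *)
Definition partial_iso (T U : eqType) (lt : rel T) (lu : rel U)
    (s : seq (T * U)) :=
  {in s &, forall p q, lt p.1 q.1 = lu p.2 q.2}.

Lemma seq_max (T : eqType) (lt : rel T) (A : seq T) :
  dense_order lt -> A != [::] ->
  exists2 m, m \in A & {in A, forall a, lt a m \/ a = m}.
Proof.
move=> dT; elim: A => // a A IH _.
have [->|/IH[m mA mP]] := eqVneq A [::].
  by exists a; rewrite ?mem_head // => b; rewrite inE => /eqP->; right.
have [am|/eqP nam] := boolP (lt a m).
  exists m; first by rewrite inE mA orbT.
  by move=> b /[!inE] /predU1P[->|/mP//]; left.
exists a; first exact: mem_head.
move=> b /[!inE] /predU1P[->|bA]; first by right.
have [->|/(lt_tot dT)/orP[]ma] := eqVneq a m; first exact: mP.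
  by rewrite ma in nam.
by left; case: (mP _ bA) => [/(lt_tr dT)->//|->].
Qed.

Lemma dense_order_flip (T : eqType) (lt : rel T) :
  dense_order lt -> dense_order (fun x y => lt y x).
Proof.
case=> i t to de mi ma inh; split=> //.
- by move=> y x z xy yz; apply: t yz xy.
- by move=> x y /to; rewrite orbC.
- by move=> x y /de[z]; exists z.
Qed.

Lemma seq_between (T : eqType) (lt : rel T) (A B : seq T) :
  dense_order lt -> {in A & B, forall a b, lt a b} ->
  exists m, {in A, forall a, lt a m} /\ {in B, forall b, lt m b}.
Proof.
move=> dT AB.
have minP := seq_max (dense_order_flip dT).
have [A0|/(seq_max dT)[a aA aP]] := eqVneq A [::];
    have [B0|/minP[b bB bP]] := eqVneq B [::].
- by have [x _] := lt_inhab dT; exists x; rewrite A0 B0.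
- have [m mb] := lt_nomin dT b; exists m; rewrite A0; split=> // x /bP[|->//].
  exact: lt_tr mb.
- have [m mb] := lt_nomax dT a; exists m; rewrite B0; split=> // x /aP[|->//].
  by move=> xa; apply: lt_tr mb.
have [m am mb] := lt_dense dT (AB _ _ aA bB); exists m; split=> x.
  by move=> /aP[xa|->//]; apply: lt_tr am.
by move=> /bP[|->//]; apply: lt_tr mb.
Qed.

Lemma partial_iso_extend (T U : eqType) (lt : rel T) (lu : rel U)
    (s : seq (T * U)) (x : T) :
  dense_order lt -> dense_order lu -> partial_iso lt lu s ->
  exists y, partial_iso lt lu ((x, y) :: s).
Proof.
move=> dT dU sP.
have ext y : {in s, forall p, lt p.1 x = lu p.2 y /\ lt x p.1 = lu y p.2} ->
    partial_iso lt lu ((x, y) :: s).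
  move=> yP p q /[!inE] /predU1P[->|ps] /predU1P[->|qs] /=.
  - by rewrite (lt_irr dT) (lt_irr dU).
  - by have [] := yP _ qs.
  - by have [] := yP _ ps.
  - exact: sP.
have [/mapP[p ps xE]|xs] := boolP (x \in [seq p.1 | p <- s]).
  by exists p.2; apply: ext => q qs; rewrite xE !sP.
pose A := [seq p.2 | p <- s & lt p.1 x]; pose B := [seq p.2 | p <- s & lt x p.1].
have [|y [yA yB]] := @seq_between _ _ A B dU.
  move=> a b /mapP[p /[!mem_filter] /andP[px ps] ->].
  move=> /mapP[q /[!mem_filter] /andP[qx qs] ->].
  by rewrite -sP //; apply: lt_tr px qx.
have asym (V : eqType) (l : rel V) u v : dense_order l -> l u v -> l v u = false.
  by move=> dV uv; apply/negP => /(lt_tr dV uv); rewrite (lt_irr dV).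
exists y; apply: ext => p ps.
have [|/(lt_tot dT)/orP[]px] := eqVneq p.1 x.
- by move=> px; rewrite -px map_f in xs.
- have lup : lu p.2 y by apply: yA; rewrite map_f // mem_filter px.
  by rewrite px lup !(asym _ _ _ _ _ px) ?(asym _ _ _ _ _ lup).
- have lup : lu y p.2 by apply: yB; rewrite map_f // mem_filter px.
  by rewrite px lup !(asym _ _ _ _ _ px) ?(asym _ _ _ _ _ lup).
Qed.

(** Starting from [s] instead of the empty list gives Cantor's isomorphism theorem and homogeneity
    at once. Stage [n] brings the elements coded by [n] in both orders into the graph. *)
Theorem back_and_forth (T U : countType) (lt : rel T) (lu : rel U)
    (s : seq (T * U)) :
  dense_order lt -> dense_order lu -> partial_iso lt lu s ->
  exists f g, [/\ cancel f g, cancel g f, {mono f : x y / lt x y >-> lu x y} &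
    {in s, forall p, f p.1 = p.2}].
Proof.
move=> dT dU sP.
have fstP x t : partial_iso lt lu t -> exists y, partial_iso lt lu ((x, y) :: t).
  exact: partial_iso_extend.
have sndP y t : partial_iso lt lu t -> exists x, partial_iso lt lu ((x, y) :: t).
  move=> tP; have [|x xP] := @partial_iso_extend _ _ lu lt [seq (p.2, p.1) | p <- t] y dU dT.
    by move=> p' q' /mapP[p pt ->] /mapP[q qt ->]; rewrite tP.
  exists x => p q pt qt.
  suff sw r : r \in (x, y) :: t -> (r.2, r.1) \in (y, x) :: [seq (p.2, p.1) | p <- t].
    by rewrite -(xP (p.2, p.1) (q.2, q.1)) //; apply: sw.
  rewrite !inE => /predU1P[->|rt]; first by rewrite eqxx.
  by rewrite (map_f (fun p : T * U => (p.2, p.1))) ?orbT.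
have stepP (nt : nat * seq (T * U)) : exists t' : seq (T * U),
    partial_iso lt lu nt.2 -> [/\ partial_iso lt lu t', {subset nt.2 <= t'},
      forall x : T, unpickle nt.1 = Some x -> exists y, (x, y) \in t' &
      forall y : U, unpickle nt.1 = Some y -> exists x, (x, y) \in t'].
  case: nt => n t /=.
  have [tP|] := pselect (partial_iso lt lu t); last by exists t.
  have [t1 [t1P t1s t1x]] : exists t1, [/\ partial_iso lt lu t1, {subset t <= t1} &
      forall x : T, unpickle n = Some x -> exists y, (x, y) \in t1].
    case E: (@unpickle T n) => [x|]; last by exists t; split=> //.
    have [y yP] := fstP x t tP; exists ((x, y) :: t); split=> //.
      by move=> p pt; rewrite inE pt orbT.
    by move=> _ [<-]; exists y; rewrite mem_head.
  case E: (@unpickle U n) => [y|]; last by exists t1 => _; split=> //.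
  have [x xP] := sndP y t1 t1P; exists ((x, y) :: t1) => _; split=> //.
  - by move=> p /t1s pt; rewrite inE pt orbT.
  - by move=> z /t1x[w zw]; exists w; rewrite inE zw orbT.
  - by move=> _ [<-]; exists x; rewrite mem_head.
have [step {}stepP] := choice stepP.
pose S := fix S n := if n is n'.+1 then step (n', S n') else s.
have SP n : partial_iso lt lu (S n).
  by elim: n => // n IH; have [] := stepP (n, S n) IH.
have SS m n : (m <= n)%N -> {subset S m <= S n}.
  elim: n => [|n IH]; first by rewrite leqn0 => /eqP->.
  rewrite leq_eqVlt => /predU1P[->//|/IH mn p /mn pn].
  by have [_ nS _ _] := stepP (n, S n) (SP n); apply: nS.
have fP x : exists y, exists n, (x, y) \in S n.
  have [_ _ /(_ x) xS _] := stepP (pickle x, S (pickle x)) (SP _).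
  by case: xS; [rewrite pickleK|move=> y xy; exists y, (pickle x).+1].
have gP y : exists x, exists n, (x, y) \in S n.
  have [_ _ _ /(_ y) yS] := stepP (pickle y, S (pickle y)) (SP _).
  by case: yS; [rewrite pickleK|move=> x xy; exists x, (pickle y).+1].
have [f {}fP] := choice fP; have [g {}gP] := choice gP.
have mono x y x' y' : (exists n, (x, y) \in S n) -> (exists n, (x', y') \in S n) ->
    lt x x' = lu y y'.
  move=> [n /(SS _ _ (leq_maxl n _))xy] [m /(SS _ _ (leq_maxr _ m))xy'].
  exact: (SP _ _ _ (xy m) (xy' n)).
have fun1 x y y' : (exists n, (x, y) \in S n) -> (exists n, (x, y') \in S n) -> y = y'.
  move=> xy xy'; apply/eqP/negPn/negP => /(lt_tot dU).
  by rewrite -(mono _ _ _ _ xy xy') -(mono _ _ _ _ xy' xy) (lt_irr dT).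
have inj1 x x' y : (exists n, (x, y) \in S n) -> (exists n, (x', y) \in S n) -> x = x'.
  move=> xy xy'; apply/eqP/negPn/negP => /(lt_tot dT).
  by rewrite (mono _ _ _ _ xy xy') (mono _ _ _ _ xy' xy) (lt_irr dU).
exists f, g; split.
- by move=> x; apply: inj1 (gP _) (fP _).
- by move=> y; apply: fun1 (fP _) (gP _).
- by move=> x x'; rewrite (mono _ _ _ _ (fP x) (fP x')).
- by move=> [x y] xy /=; apply: fun1 (fP _) _; exists 0%N.
Qed.

(** * Automorphisms of the order of the rationals *)

Definition aut (f : rat -> rat) : Prop :=
  {mono f : x y / x < y} /\ forall y, exists x, f x = y.

Definition rinv (f : rat -> rat) (y : rat) : rat := xget 0 [set x | f x = y].

Lemma mono_rat_inj (f : rat -> rat) : {mono f : x y / x < y} -> injective f.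
Proof.
move=> fm x y fxy; apply/eqP; case: ltgtP => // xy.
  by move: (fm x y); rewrite fxy ltxx xy.
by move: (fm y x); rewrite fxy ltxx xy.
Qed.

Lemma aut_inj f : aut f -> injective f. Proof. by case=> /mono_rat_inj. Qed.

Lemma autV f : aut f -> cancel (rinv f) f.
Proof. by move=> [_ fs] y; have [x xy] := fs y; apply: (@xgetPex _ 0 [set x | f x = y]); exists x. Qed.

Lemma autK f : aut f -> cancel f (rinv f).
Proof. by move=> fa x; apply: (aut_inj fa); rewrite autV. Qed.

Lemma aut_lt f : aut f -> {mono f : x y / x < y}. Proof. by case. Qed.

Lemma aut_le f : aut f -> {mono f : x y / x <= y}.
Proof. by move=> fa x y; rewrite !leNgt aut_lt. Qed.

Lemma aut_can f g : {mono f : x y / x < y} -> cancel g f -> aut f.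
Proof. by move=> fm gf; split=> // y; exists (g y). Qed.

Lemma aut_id : aut id. Proof. by split=> // y; exists y. Qed.

Lemma aut_comp f g : aut f -> aut g -> aut (f \o g).
Proof.
move=> [fm fs] [gm gs]; split=> [x y|z] /=; first by rewrite fm gm.
by have [y <-] := fs z; have [x <-] := gs y; exists x.
Qed.

Lemma aut_rinv f : aut f -> aut (rinv f).
Proof.
move=> fa; apply: (@aut_can _ f); last exact: autK.
by move=> x y; rewrite -[in RHS](autV fa x) -[in RHS](autV fa y) (aut_lt fa).
Qed.

Lemma rinv_eq f x y : aut f -> f x = y -> rinv f y = x.
Proof. by move=> fa <-; rewrite autK. Qed.

Lemma rat_dense_order : dense_order (fun x y : rat => x < y).
Proof.
split.
- exact: ltxx.
- exact: lt_trans.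
- by move=> x y; rewrite neq_lt.
- by move=> x y xy; exists ((x + y) / 2%:R); lra.
- by move=> x; exists (x - 1); lra.
- by move=> x; exists (x + 1); lra.
- by exists 0.
Qed.

Lemma aut_extend (s : seq (rat * rat)) :
  {in s &, forall p q, p.1 < q.1 -> p.2 < q.2} ->
  {in s &, forall p q, p.1 = q.1 -> p.2 = q.2} ->
  exists2 f, aut f & {in s, forall p, f p.1 = p.2}.
Proof.
move=> slt seq.
have [|f [g [fK gK fm fs]]] := @back_and_forth _ _ _ _ s rat_dense_order rat_dense_order.
  move=> p q ps qs; apply/idP/idP => [|pq]; first exact: slt.
  case: ltgtP => // [/(slt _ _ qs ps)|/(seq _ _ ps qs)]; lra.
by exists f => //; apply: aut_can gK.
Qed.

Lemma aut_extend_sorted (s : seq (rat * rat)) :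
  sorted (fun p q => (p.1 < q.1) && (p.2 < q.2)) s ->
  exists2 f, aut f & {in s, forall p, f p.1 = p.2}.
Proof.
set r := (X in sorted X) => ss.
have rtr : transitive r by move=> y x z /andP[a b] /andP[c d]; rewrite /r; lra.
have sub : {in s &, forall p q, [|| p == q, r p q | r q p]}.
  move: ss; rewrite sorted_pairwise //; elim: s => // a s IH /= /andP[/allP al /IH{}IH].
  move=> p q /[!inE] /predU1P[->|ps] /predU1P[->|qs].
  - by rewrite eqxx.
  - by rewrite al ?orbT.
  - by rewrite [r a p]al ?orbT.
  - exact: (IH _ _ ps qs).
apply: aut_extend => p q ps qs; have := sub _ _ ps qs; rewrite /r.
  by case/or3P => [/eqP->|/andP[]//|]; lra.
by case/or3P => [/eqP->//| |]; lra.
Qed.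

(** The inverse of a maximum is the minimum of the inverses. Maxima let one automorphism exceed
    finitely many others in [block_dominate]. *)
Lemma aut_max f g : aut f -> aut g -> aut (fun x => Num.max (f x) (g x)).
Proof.
move=> fa ga; split=> [x y|z].
  apply/idP/idP; last first.
    rewrite -(aut_lt fa) => fxy; have gxy : g x < g y by rewrite (aut_lt ga) -(aut_lt fa).
    by rewrite gt_max !lt_max fxy gxy orbT.
  rewrite lt_max !gt_max => /orP[/andP[]|/andP[_]]; by rewrite ?(aut_lt fa) ?(aut_lt ga).
exists (Num.min (rinv f z) (rinv g z)).
have [le|/ltW le] := leP (rinv f z) (rinv g z).
  by rewrite autV //; apply: max_idPl; rewrite -(autV ga z) aut_le // (autV ga).
by rewrite (autV ga) //; apply: max_idPr; rewrite -(autV fa z) aut_le // (autV fa).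
Qed.

Lemma aut_iter f m : aut f -> aut (iter m f).
Proof. by move=> fa; elim: m => [|m IH]; [apply: aut_id|apply: (aut_comp fa IH)]. Qed.

(** Conjugation by the reversal of the order, so that results about decreasing sequences also serve
    increasing ones. *)
Definition opp_conj (f : rat -> rat) (x : rat) : rat := - f (- x).

Lemma opp_conjK f : opp_conj (opp_conj f) = f.
Proof. by apply/funext => x; rewrite /opp_conj !opprK. Qed.

Lemma aut_opp_conj f : aut f -> aut (opp_conj f).
Proof.
move=> [fm fs]; split=> [x y|y]; first by rewrite /opp_conj ltrN2 fm ltrN2.
by have [x xy] := fs (- y); exists (- x); rewrite /opp_conj opprK xy opprK.
Qed.

Lemma opp_conj_comp f g : opp_conj (f \o g) = opp_conj f \o opp_conj g.
Proof. by apply/funext => x; rewrite /opp_conj /= opprK. Qed.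

Lemma opp_conj_rinv f : aut f -> opp_conj (rinv f) = rinv (opp_conj f).
Proof.
move=> fa; apply/funext => x; apply/esym/rinv_eq; first exact: aut_opp_conj.
by rewrite /opp_conj opprK autV // opprK.
Qed.

(** * Gluing automorphisms over convex pieces *)

Section Glue.
Variables (J : eqType) (b : rat -> option J).

Definition convex_label :=
  forall j x y z, x < y -> y < z -> b x = Some j -> b z = Some j -> b y = Some j.

Definition glue (g : J -> rat -> rat) (x : rat) : rat :=
  if b x is Some j then g j x else x.

(** Each map keeps its own piece, and a point moving inside a convex piece cannot pass a point
    outside it, so comparisons between different pieces survive. *)
Lemma aut_glue g : convex_label -> (forall j, aut (g j)) ->
  (forall j x, b (g j x) = Some j <-> b x = Some j) -> aut (glue g).
Proof.
move=> bc ga gb.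
have lab x j : b x = Some j -> b (glue g x) = Some j.
  by move=> bx; rewrite /glue bx gb.
have mon x y : x < y -> glue g x < glue g y.
  move=> xy; case bx: (b x) => [i|]; case gy: (b y) => [j|].
  - have [ij|ij] := eqVneq i j; first by rewrite /glue bx gy ij aut_lt.
    have gx' := lab _ _ bx; have gy' := lab _ _ gy.
    have ne u v : b u = Some i -> b v = Some j -> u != v.
      by move=> bu bv; apply: contra_neq ij => uv; move: bu; rewrite uv bv => -[].
    have gxy : glue g x < y.
      rewrite lt_neqAle ne // leNgt; apply/negP => yg.
      by move: gy; rewrite (bc _ _ _ _ xy yg bx gx') => -[] /eqP; rewrite (negPf ij).
    rewrite lt_neqAle ne // leNgt; apply/negP => yg.
    by move: gx'; rewrite (bc _ _ _ _ yg gxy gy' gy) => -[] /eqP; rewrite eq_sym (negPf ij).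
  - have gx' := lab _ _ bx; rewrite [glue g y]/glue gy lt_neqAle; apply/andP; split.
      by apply/eqP => e; move: gx'; rewrite e gy.
    by rewrite leNgt; apply/negP => yg; have := bc _ _ _ _ xy yg bx gx'; rewrite gy.
  - have gy' := lab _ _ gy; rewrite [glue g x]/glue bx lt_neqAle; apply/andP; split.
      by apply/eqP => e; move: gy'; rewrite -e bx.
    by rewrite leNgt; apply/negP => yg; have := bc _ _ _ _ yg xy gy' gy; rewrite bx.
  - by rewrite /glue bx gy.
split=> [x y|y].
  apply/idP/idP; last exact: mon.
  by case: (ltgtP x y) => // [/mon|->]; lra.
case gy: (b y) => [j|]; last by exists y; rewrite /glue gy.
exists (rinv (g j) y); have e := autV (ga j) y.
by rewrite /glue (_ : b _ = Some j) ?e // -gb e.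
Qed.

Definition in_label (A : pred J) (x : rat) : bool := if b x is Some j then A j else false.

Definition block_aut (A : pred J) (g : rat -> rat) : Prop :=
  [/\ aut g, forall x, b (g x) = b x & forall x, ~~ in_label A x -> g x = x].

Variable A : pred J.

Lemma block_aut_id : block_aut A id. Proof. by split=> //; apply: aut_id. Qed.

Lemma block_aut_comp g h : block_aut A g -> block_aut A h -> block_aut A (g \o h).
Proof.
case=> ga gb gA [ha hb hA]; split=> [|x|x xA] /=; first exact: aut_comp.
  by rewrite gb hb.
by rewrite (hA x) // gA.
Qed.

Lemma block_aut_rinv g : block_aut A g -> block_aut A (rinv g).
Proof.
case=> ga gb gA; split=> [|x|x xA]; first exact: aut_rinv.
  by rewrite -[in RHS](autV ga x) gb.
by apply: rinv_eq => //; apply: gA.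
Qed.

Lemma block_aut_max g h :
  block_aut A g -> block_aut A h -> block_aut A (fun x => Num.max (g x) (h x)).
Proof.
case=> ga gb gA [ha hb hA]; split=> [|x|x xA]; first exact: aut_max.
  by rewrite maxEle; case: ifP.
by rewrite gA // hA // maxxx.
Qed.

Lemma block_aut_glue g : convex_label -> (forall j, block_aut A (g j)) ->
  block_aut A (glue g).
Proof.
move=> bc gA; split=> [|x|x xA].
- by apply: aut_glue => [//|j|j x]; have [ga gb _] := gA j; rewrite ?gb.
- by rewrite /glue; case bx: (b x) => [j|//]; have [_ ->] := gA j.
- by rewrite /glue; case bx: (b x) => [j|//]; have [_ _ ->] := gA j.
Qed.

End Glue.

Lemma block_aut_sub (J : eqType) (b : rat -> option J) (A A' : pred J) g :
  {subset A <= A'} -> block_aut b A g -> block_aut b A' g.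
Proof.
move=> AA' [ga gb gA]; split=> // x xA; apply: gA; apply: contra xA.
by rewrite /in_label; case: (b x) => // j; apply: AA'.
Qed.

Definition block_restrict (J : eqType) (b : rat -> option J) (A : pred J) g :=
  glue b (fun j => if A j then g else id).

Lemma block_restrictP (J : eqType) (b : rat -> option J) (A A' : pred J) g :
  convex_label b -> block_aut b A' g -> block_aut b (predI A A') (block_restrict b A g).
Proof.
move=> bc [ga gb gA]; split=> [|x|x].
- apply: aut_glue => [//|j|j x]; case: ifP => // _; first exact: aut_id.
  by rewrite gb.
- by rewrite /block_restrict /glue; case bx: (b x) => [j|//]; case: ifP => // _; rewrite gb.
- rewrite /block_restrict /glue /in_label; case bx: (b x) => [j|//] /=.
  by case: ifP => //= _ A'j; apply: gA; rewrite /in_label bx.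
Qed.

(** * Subgroups of countable index *)

(** Countable index is encoded by a labelling with naturals whose fibres lie inside left cosets; in
    the application [kappa] is the code of the image of a point of a countable set. *)
Record small_index (K : set (rat -> rat)) : Prop := SmallIndex {
  small_aut : forall g, K g -> aut g;
  small_comp : forall g h, K g -> K h -> K (g \o h);
  small_rinv : forall g, K g -> K (rinv g);
  small_countable : exists kappa : (rat -> rat) -> nat,
    forall g h, aut g -> aut h -> kappa g = kappa h -> K (rinv g \o h) }.

Lemma small_id K : small_index K -> K id.
Proof.
move=> sK; have [kappa kP] := small_countable sK.
rewrite (_ : id = rinv id \o id); first exact: kP aut_id aut_id _.
by apply/funext => x /=; apply/esym/rinv_eq => //; apply: aut_id.
Qed.

Lemma small_conj K g h : small_index K -> K h -> aut g -> K (rinv h \o g \o h) -> K g.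
Proof.
move=> sK Kh ga Kg; have ha := small_aut sK Kh.
rewrite (_ : g = h \o (rinv h \o g \o h) \o rinv h).
  by apply: (small_comp sK); [exact: (small_comp sK)|exact: (small_rinv sK)].
by apply/funext => x; rewrite /= !autV.
Qed.

Lemma small_quot K g h : small_index K -> K h -> aut g -> K (rinv h \o g) -> K g.
Proof.
move=> sK Kh ga Kg; rewrite (_ : g = h \o (rinv h \o g)); first exact: (small_comp sK).
by apply/funext => x; rewrite /= autV //; apply: small_aut Kh.
Qed.

Lemma small_opp_conj K : small_index K -> small_index [set g | K (opp_conj g)].
Proof.
move=> sK; split=> [g|g h|g|] /=.
- by move=> /(small_aut sK) /aut_opp_conj; rewrite opp_conjK.
- by rewrite opp_conj_comp; apply: small_comp.
- move=> Kg; rewrite opp_conj_rinv; first exact: small_rinv.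
  by have := aut_opp_conj (small_aut sK Kg); rewrite opp_conjK.
have [kappa kP] := small_countable sK; exists (kappa \o opp_conj) => g h ga ha /= e.
rewrite opp_conj_comp opp_conj_rinv //.
by apply: kP => //; apply: aut_opp_conj.
Qed.

(* Representatives [c i] of the cosets of [K], taken inside [P] when possible. *)
Lemma small_reps K (P : set (rat -> rat)) : small_index K -> P id ->
  (forall g, P g -> aut g) ->
  exists (kappa : (rat -> rat) -> nat) (c : nat -> rat -> rat),
    (forall i, P (c i)) /\ forall g, P g -> K (rinv (c (kappa g)) \o g).
Proof.
move=> sK P1 Pa; have [kappa kP] := small_countable sK.
have /choice[c cP] i : exists c, P c /\ forall g, P g -> kappa g = i -> kappa c = i.
  have [[g [Pg gi]]|N] := pselect (exists g, P g /\ kappa g = i); first by exists g.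
  by exists id; split=> // g Pg gi; case: N; exists g.
exists kappa, c; split=> [i|g Pg]; first by have [] := cP i.
have [Pc cg] := cP (kappa g).
by apply: kP; [apply: Pa|apply: Pa|apply: (cg g)].
Qed.

Section Blocks.
Variables (K : set (rat -> rat)) (J : eqType) (b : rat -> option J).
Hypotheses (sK : small_index K) (bc : convex_label b).

(* Diagonalising against the countably many cosets of [K]. *)
Lemma block_project (a : J -> nat) : exists n, forall g,
  block_aut b (fun j => a j == n) g ->
  exists k, [/\ K k, block_aut b predT k &
    forall x, in_label b (fun j => a j == n) x -> k x = g x].
Proof.
apply: contrapT => /forallNP N.
have [kappa [c [cP ck]]] := small_reps sK (block_aut_id b predT) (fun g '(And3 h _ _) => h).
have /choice[g gP] n : exists g, block_aut b (fun j => a j == n) g /\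
    ~ exists k, [/\ K k, block_aut b predT k &
      forall x, in_label b (fun j => a j == n) x -> k x = g x].
  by have /existsNP[g /not_implyP gP] := N n; exists g.
have gT n : block_aut b predT (g n).
  by have [gn _] := gP n; apply: block_aut_sub gn.
(* On the blocks with [a j = n], [h] is the representative of coset [n] after the counterexample
   [g n]. At [n = kappa h] the element [rinv (c n) \o h] of [K] therefore agrees with [g n]
   there. *)
pose h := glue b (fun j => c (a j) \o g (a j)).
have hP : block_aut b predT h.
  by apply: block_aut_glue => // j; apply: block_aut_comp.
have [_] := gP (kappa h); apply; exists (rinv (c (kappa h)) \o h); split.
- exact: ck.
- exact/block_aut_comp/hP/block_aut_rinv.
move=> x; rewrite /in_label /h /= /glue; case bx: (b x) => [j|//] /eqP ->.
by rewrite autK //; have [] := cP (kappa (glue b (fun j0 : J => c (a j0) \o g (a j0)))).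
Qed.

(** [M i] is the maximum of the maps [c l \o tau] for [l <= i], and [g] uses [M i] on the blocks of
    rank [i]. If [g] lies in the coset of [c n], it is at least [c n \o tau] on every block of rank
    at least [n], so [rinv (c n) \o g] is at least [tau] there. *)
Lemma block_dominate (A : pred J) (r : J -> nat) tau : block_aut b A tau ->
  exists s n, [/\ K s, block_aut b A s &
    forall x j, b x = Some j -> (n <= r j)%N -> tau x <= s x].
Proof.
move=> tP.
have [kappa [c [cP ck]]] := small_reps sK (block_aut_id b A) (fun g '(And3 h _ _) => h).
pose M := fix M i x := if i is i'.+1 then Num.max (M i' x) (c i (tau x)) else c 0%N (tau x).
have MP i : block_aut b A (M i).
  by elim: i => [|i IH]; [|apply: block_aut_max => //]; apply: block_aut_comp.
have Mge i m x : (i <= m)%N -> c i (tau x) <= M m x.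
  elim: m => [|m IH]; first by rewrite leqn0 => /eqP->.
  rewrite leq_eqVlt => /predU1P[->|/IH]; first by rewrite /= le_max lexx orbT.
  by rewrite /= le_max => ->.
pose g := glue b (fun j => M (r j)).
have gP : block_aut b A g by apply: block_aut_glue.
have ca := cP (kappa g); exists (rinv (c (kappa g)) \o g), (kappa g); split.
- exact: ck.
- exact/block_aut_comp/gP/block_aut_rinv.
move=> x j bx nr; have [caa _ _] := ca.
rewrite -(aut_le caa) /= autV // [g x]/g /glue bx.
exact: Mge.
Qed.

End Blocks.

(* [g] is the commutator of [s], which moves every [lo j] past [hi j], and of
   the infinite product of the conjugates of [g] by the powers of [s]. *)
Lemma block_commutator (K : set (rat -> rat)) (J : eqType) (b : rat -> option J)
    (a r : J -> nat) (lo hi : J -> rat) tau :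
  small_index K -> convex_label b -> block_aut b predT tau ->
  (forall j, b (lo j) = Some j) -> (forall j, lo j < hi j <= tau (lo j)) ->
  exists n n0, forall g, block_aut b predT g ->
    (forall x, g x != x ->
      exists j, [/\ b x = Some j, a j = n, (n0 <= r j)%N & lo j <= x < hi j]) ->
    K g.
Proof.
move=> sK bc tP blo lohi.
have [n nP] := block_project sK bc a; pose A j := a j == n.
have t'P : block_aut b A (block_restrict b A tau).
  by apply: block_aut_sub (block_restrictP A bc tP) => j /andP[].
have [s [n0 [Ks sP sge]]] := block_dominate sK bc r t'P.
exists n, n0 => g gP gD; have [ga gb _] := gP; have [sa sb sA] := sP.
pose ok j := A j && (n0 <= r j)%N.
have slo j : ok j -> hi j <= s (lo j).
  case/andP => Aj rj; have /andP[_ h] := lohi j; apply: le_trans h _.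
  by rewrite (le_trans _ (sge _ _ (blo j) rj)) // /block_restrict /glue blo Aj.
(* On an [ok] block the intervals from [T j m] to [T j m.+1] are disjoint and [s] carries each to
   the next; by [slo] the first one contains what [g] moves in that block. *)
pose T j m := iter m s (lo j).
have Tlt j m : ok j -> T j m < T j m.+1.
  move=> oj; rewrite /T iterSr (aut_lt (aut_iter m sa)).
  by apply: lt_le_trans (slo _ oj); have /andP[] := lohi j.
have Tle j m m' : ok j -> (m <= m')%N -> T j m <= T j m'.
  move=> oj; elim: m' => [|m' IH]; first by rewrite leqn0 => /eqP->.
  rewrite leq_eqVlt => /predU1P[->//|/IH h]; apply: le_trans h _.
  exact/ltW/Tlt.
have Tuniq j m m' x : ok j -> T j m <= x < T j m.+1 -> T j m' <= x < T j m'.+1 -> m = m'.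
  move=> oj /andP[h1 h2] /andP[h3 h4]; apply/eqP; rewrite eqn_leq; apply/andP; split.
    rewrite -ltnS ltnNge; apply/negP => /(Tle _ _ _ oj); lra.
  rewrite -ltnS ltnNge; apply/negP => /(Tle _ _ _ oj); lra.
have /choice[c cP] x : exists o : option (J * nat), forall j m, o = Some (j, m) <->
    [/\ b x = Some j, ok j & T j m <= x < T j m.+1].
  have [[[j m] [bx oj Tx]]|N] := pselect (exists p : J * nat,
      [/\ b x = Some p.1, ok p.1 & T p.1 p.2 <= x < T p.1 p.2.+1]).
    exists (Some (j, m)) => j' m'; split=> [[<- <-]//|[bx' oj' Tx']].
    have jj' : j = j' by move: bx'; rewrite bx => -[].
    by subst j'; congr (Some (_, _)); apply: Tuniq Tx Tx'.
  by exists None => j m; split=> // h; case: N; exists (j, m).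
have cc : convex_label c.
  move=> [j m] x y z xy yz /cP[bx oj /andP[Tx _]] /cP[bz _ /andP[_ Tz]].
  by apply/cP; split=> //; [apply: bc xy yz bx bz|lra].
have gfix x : (forall j, b x = Some j -> ok j -> ~~ (lo j <= x < hi j)) -> g x = x.
  move=> h; apply/eqP/negPn/negP => /gD[j [bx aj rj]]; apply/negP/h => //.
  by rewrite /ok /A aj eqxx rj.
have gmv x j : b x = Some j -> ok j -> g x != x -> lo j <= x < hi j.
  by move=> bx _ /gD[i [bx' _ _]]; move: bx; rewrite bx' => -[<-].
have gin x j : b x = Some j -> ok j -> (lo j <= g x < s (lo j)) = (lo j <= x < s (lo j)).
  move=> bx oj; have [->//|gx] := eqVneq (g x) x.
  have := gmv _ _ bx oj gx; have bgx : b (g x) = Some j by rewrite gb.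
  have ggx : g (g x) != g x by rewrite (inj_eq (aut_inj ga)).
  have := gmv _ _ bgx oj ggx; have := slo _ oj => h1 h2 h3.
  by apply/idP/idP => _; lra.
have sia m : aut (iter m s) by apply: aut_iter.
pose h (p : J * nat) := iter p.2 s \o g \o rinv (iter p.2 s).
have cE x j m : c x = Some (j, m) <->
    [/\ b x = Some j, ok j & lo j <= rinv (iter m s) x < s (lo j)].
  rewrite cP /T iterSr; split=> -[bx oj Tx]; split=> //.
    by rewrite -(aut_le (sia m)) -(aut_lt (sia m)) autV.
  by move: Tx; rewrite -(aut_le (sia m)) -(aut_lt (sia m)) autV.
have iterb m x : b (iter m s x) = b x by elim: m => //= m IH; rewrite sb.
have riterb m x : b (rinv (iter m s) x) = b x by rewrite -{2}(autV (sia m) x) iterb.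
have hb p x : b (h p x) = b x by rewrite /h /= iterb gb riterb.
have hc p x : c (h p x) = Some p <-> c x = Some p.
  case: p => j m; rewrite !cE hb [h _]/h /= autK //.
  split=> -[bx oj Tx]; split=> //; move: Tx; rewrite gin //; by rewrite riterb.
pose gh := glue c h.
have gha : aut gh.
  by apply: aut_glue => // p; apply: aut_comp (aut_rinv _) => //; apply: aut_comp.
have ghb x : b (gh x) = b x by rewrite /gh /glue; case: (c x).
have ghA : block_aut b A gh.
  split=> // x xA; rewrite /gh /glue; case cx: (c x) => [[j m]|//].
  move: cx xA => /cP[bx /andP[Aj _] _]; rewrite /in_label bx.
  by rewrite Aj.
have [k [Kk kP kgh]] := nP _ ghA; have [ka kb _] := kP.
have cS x j m : c (s x) = Some (j, m.+1) <-> c x = Some (j, m).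
  by rewrite !cP sb /T !iterS -!(iterS _ s) /= (aut_le sa) (aut_lt sa).
(* Conjugation by [s] turns factor [m] of the product [gh] into factor [m.+1], so only factor [0],
   which is [g], is lost. Outside the blocks of [A], where [k] is only known to preserve blocks, [s]
   and [g] are trivial. *)
have key x : g (s (k x)) = k (s x).
  have [xA|xA] := boolP (in_label b A x); last first.
    have kxA : ~~ in_label b A (k x) by rewrite /in_label kb.
    rewrite (sA x) // (sA (k x)) //; apply: gfix => j bj /andP[Aj _].
    by move: kxA; rewrite /in_label bj Aj.
  have sxA : in_label b A (s x) by rewrite /in_label sb.
  rewrite !kgh // /gh /glue.
  case cx: (c x) => [[j m]|].
    have csx : c (s x) = Some (j, m.+1) by apply/cS.
    have hsx : s (h (j, m) x) = h (j, m.+1) (s x).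
      rewrite /h /=; congr (s (iter m s (g _))); apply: esym.
      by apply: (rinv_eq (aut_iter m.+1 sa)); rewrite /= autV.
    rewrite csx -hsx; apply: gfix => i bi oi.
    have : c (s (h (j, m) x)) = Some (j, m.+1) by rewrite hsx hc.
    case/cP; rewrite bi => -[<-] _ /andP[+ _].
    have := slo _ oi; have := Tle i 1%N m.+1 oi isT; rewrite {1}/T /= => h1 h2 h3.
    by apply/negP; lra.
  case csx: (c (s x)) => [[j [|m]]|].
  - by rewrite /h /= (_ : rinv (iter 0 s) (s x) = s x) //; apply: rinv_eq => //; apply: aut_id.
  - by move/cS: csx; rewrite cx.
  - apply: gfix => j bj oj; apply/negP => lsh.
    have : c (s x) = Some (j, 0%N).
      by apply/cP; split=> //; rewrite /T /=; have := slo _ oj; lra.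
    by rewrite csx.
rewrite (_ : g = k \o s \o rinv k \o rinv s).
  apply: (small_comp sK); last exact: (small_rinv sK).
  apply: (small_comp sK); last exact: (small_rinv sK).
  exact: (small_comp sK).
by apply/funext => x /=; rewrite -key !autV.
Qed.

Lemma small_conjV K s g : small_index K -> K s -> aut g -> K (s \o g \o rinv s) -> K g.
Proof.
move=> sK Ks ga Kg; have sa := small_aut sK Ks.
apply: (small_conj sK (small_rinv sK Ks) ga).
rewrite (_ : rinv (rinv s) = s) //; apply/funext => x.
by apply: rinv_eq; [apply: aut_rinv|rewrite autK].
Qed.

(** * Sequences of consecutive intervals *)

Definition decreasing (z : nat -> rat) := forall k, z k.+1 < z k.

Lemma decreasing_lt z i j : decreasing z -> (i < j)%N -> z j < z i.
Proof.
move=> zd; elim: j => // j IH; rewrite ltnS leq_eqVlt => /predU1P[->//|/IH].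
exact: lt_trans.
Qed.

Lemma decreasing_le z i j : decreasing z -> (i <= j)%N -> z j <= z i.
Proof. by move=> zd; rewrite leq_eqVlt => /predU1P[->//|/(decreasing_lt zd)/ltW]. Qed.

Lemma decreasing_ltP z i j x : decreasing z -> z i <= x -> x < z j -> (j < i)%N.
Proof.
by move=> zd zx xz; rewrite ltnNge; apply/negP => /(decreasing_le zd); lra.
Qed.

(** The half-open intervals tile the points below [z 0] and above some [z k]; the limit of [z] may
    be any cut, or minus infinity. *)
Definition block (z : nat -> rat) (x : rat) : option nat :=
  if pselect (exists k, z k.+1 <= x < z k) is left h then Some (projT1 (cid h)) else None.

Lemma blockP z x k : decreasing z -> block z x = Some k <-> z k.+1 <= x < z k.
Proof.
move=> zd; rewrite /block; case: pselect => [h|N]; last by split=> // h; case: N; exists k.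
case: cid => i /= zi; split=> [[<-]//|zk]; congr Some.
have := decreasing_ltP zd (proj1 (andP zi)) (proj2 (andP zk)).
have := decreasing_ltP zd (proj1 (andP zk)) (proj2 (andP zi)).
lia.
Qed.

Lemma block_convex z : decreasing z -> convex_label (block z).
Proof.
by move=> zd k x y t xy yt /blockP-/(_ zd) hx /blockP-/(_ zd) ht; apply/blockP => //; lra.
Qed.

Lemma block_autI (J : eqType) (b : rat -> option J) g : aut g ->
  (forall x, g x != x -> exists j, b x = Some j /\ b (g x) = Some j) ->
  block_aut b predT g.
Proof.
move=> ga gb; split=> // x.
  by have [->//|/gb[j [-> ->]]] := eqVneq (g x) x.
by move=> xb; apply/eqP/negPn/negP => /gb[j [bx _]]; rewrite /in_label bx in xb.
Qed.

Lemma block_push z lo hi : decreasing z ->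
  (forall k, z k.+1 < lo k < z k) -> (forall k, z k.+1 < hi k < z k) ->
  exists2 tau, block_aut (block z) predT tau & forall k, tau (lo k) = hi k.
Proof.
move=> zd loz hiz.
have /choice[t tP] k : exists t, [/\ aut t, t (z k.+1) = z k.+1, t (lo k) = hi k & t (z k) = z k].
  have [|t ta tP] := @aut_extend_sorted [:: (z k.+1, z k.+1); (lo k, hi k); (z k, z k)].
    by have := loz k; have := hiz k; rewrite /=; lra.
  exists t; split=> //; first by apply: (tP (_, _)); rewrite inE eqxx.
    by apply: (tP (_, _)); rewrite !inE eqxx !orbT.
  by apply: (tP (_, _)); rewrite !inE eqxx !orbT.
have lab k x : block z (t k x) = Some k <-> block z x = Some k.
  have [ta t1 _ t2] := tP k; rewrite !blockP //.
  by rewrite -{1}t1 -{1}t2 (aut_le ta) (aut_lt ta).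
exists (glue (block z) t).
  have ga : aut (glue (block z) t).
    by apply: aut_glue => //; [apply: block_convex|move=> k; have [] := tP k].
  apply: block_autI => // x; rewrite /glue; case bx: (block z x) => [k|]; last by rewrite eqxx.
  by move=> _; exists k; split=> //; apply/lab.
move=> k; rewrite /glue (_ : block z (lo k) = Some k); first by have [] := tP k.
by apply/blockP => //; have := loz k; lra.
Qed.

(** [block_commutator] yields only the intervals selected by one value of [a], but infinitely many
    of them. The others form gaps between consecutive selected ones, and a second domination gives
    [s] in [K] that pushes each far gap into the selected interval just above it. Conjugating by [s]
    reduces to the selected intervals. *)
Lemma tail_blocks K z : small_index K -> decreasing z ->
  exists k0, forall g, aut g -> (forall k, g (z k) = z k) ->
    (forall x, g x != x -> exists2 k, (k0 <= k)%N & z k.+1 <= x < z k) -> K g.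
Proof.
move=> sK zd.
have mid x y : x < y -> exists m : rat, x < m < y.
  by move=> xy; exists ((x + y) / 2%:R); lra.
(* Each block of [w] contains one odd-numbered interval of [z] in its interior, which leaves room to
   push its lower end to its upper end. *)
have /choice[w wP] k : exists m, z k.*2.+1 < m < z k.*2 by apply: mid.
have wd : decreasing w.
  by move=> k; have := wP k; have := wP k.+1; rewrite doubleS; have := zd k.*2.+1; lra.
pose lo k := z k.*2.+2; pose hi k := z k.*2.+1.
have lohi k : [&& w k.+1 < lo k, lo k < hi k & hi k < w k].
  by rewrite /lo /hi zd; have := wP k; have := wP k.+1; rewrite doubleS; lra.
have wlab k x : lo k <= x < hi k -> block w x = Some k.
  by move=> xk; apply/blockP => //; have := lohi k; lra.
have [||tau tauP tauE] := @block_push w lo hi wd; try by move=> k; have := lohi k; lra.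
(* Any function taking every value infinitely often would do, since the value [n] is not under
   control. *)
pose a k := logn 2 k.+1.
have [||n [n0 nP]] := block_commutator a id sK (block_convex wd) tauP (lo := lo) (hi := hi).
- by move=> k; apply: wlab; have := lohi k; lra.
- by move=> k; rewrite tauE; have := lohi k; lra.
(* An increasing list of indices with [a = n], as [(e j).+1] is [2 ^ n] times an odd number; adding
   [n0] keeps them at least [n0]. *)
pose e j := (2 ^ n * (j + n0).*2.+1).-1.
have eS j : (e j).+1 = (2 ^ n * (j + n0).*2.+1)%N.
  by rewrite prednK // muln_gt0 expn_gt0.
have ae j : a (e j) = n.
  rewrite /a eS lognM ?expn_gt0 // lognX logn_prime // eqxx muln1 lognE /=.
  by rewrite dvdn2 /= odd_double /= addn0.
have en0 j : (n0 <= e j)%N.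
  rewrite -ltnS eS (leq_trans _ (leq_pmull _ _)) ?expn_gt0 // ltnS.
  by rewrite -addnn -addnA (leq_trans (leq_addl j n0)) // addnA leq_addr.
have eltS j : (e j < e j.+1)%N.
  by rewrite -ltnS !eS ltn_pmul2l ?expn_gt0 // addSn doubleS; lia.
have elt i j : (i < j)%N -> (e i < e j)%N.
  by elim: j => // j IH; rewrite ltnS leq_eqVlt => /predU1P[->//|/IH/ltn_trans->].
have ele i j : (i <= j)%N -> (e i <= e j)%N.
  by rewrite leq_eqVlt => /predU1P[->//|/elt/ltnW].
have jle j : (j <= e j)%N by elim: j => // j IH; apply: leq_ltn_trans IH (eltS j).
have /choice[m mP] j : exists m : rat, z (e j).*2.+2 < m < z (e j).*2.+1 by apply: mid.
(* The gap from [l j] to [r j] holds the intervals strictly between two consecutive selected ones,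
   and [m j] is interior to the selected interval above it. *)
pose l j := z (e j.+1).*2.+1; pose r j := z (e j).*2.+2.
have lr j : l j < r j by apply: (@decreasing_lt z) => //; have := eltS j; lia.
have md j : m j.+1 < m j.
  by have := mP j; have := mP j.+1; have := lr j; rewrite /l /r; lra.
have lrm j : [&& m j.+1 < l j, l j < r j & r j < m j].
  by rewrite lr; have := mP j; have := mP j.+1; rewrite /l /r; lra.
have [||tau2 tau2P tau2E] := @block_push m l r md; try by move=> j; have := lrm j; lra.
have [s [j0 [Ks sP sge]]] := block_dominate sK (block_convex md) id tau2P.
have [sa sb _] := sP.
have sgap j x : (j0 <= j)%N -> l j <= x < r j -> r j <= s x < m j.
  move=> jj /andP[lx xr]; have := lrm j => h.
  have bx : block m x = Some j by apply/blockP => //; lra.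
  have bl : block m (l j) = Some j by apply/blockP => //; lra.
  have : block m (s x) = Some j by rewrite sb.
  have := sge _ _ bl jj; rewrite tau2E => h1 /blockP-/(_ md)/andP[_ ->].
  by rewrite andbT (le_trans h1) // (aut_le sa).
(* From this index on, every interval is selected or lies in a gap numbered at least [j0], where [s]
   is controlled. *)
exists (e j0).*2.+2 => g ga gz gD.
pose AB k := `[< exists j, k = (e j).*2.+1 >].
have ABP k : reflect (exists j, k = (e j).*2.+1) (AB k) by apply: asboolP.
have gb x k : block z (g x) = Some k <-> block z x = Some k.
  by rewrite !blockP // -{1}(gz k) -{1}(gz k.+1) (aut_le ga) (aut_lt ga).
have gP : block_aut (block z) predT g.
  apply: block_autI => // x /gD[k _ /blockP-/(_ zd) bx].
  by exists k; split=> //; apply/gb.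
have [g1a g1b g1x] := block_restrictP AB (block_convex zd) gP.
set g1 := block_restrict _ _ _ in g1a g1b g1x.
have g1E x k : block z x = Some k -> g1 x = if AB k then g x else x.
  by rewrite /g1 /block_restrict /glue => ->; case: ifP.
have nolab x : block z x = None -> g x = x.
  by move=> bx; apply/eqP/negPn/negP => /gD[k _ /blockP-/(_ zd)]; rewrite bx.
have Kg1 : K g1.
  have g1D x : g1 x != x -> exists j, [/\ block w x = Some (e j), block w (g1 x) = Some (e j),
      lo (e j) <= x & x < hi (e j)].
    case bx: (block z x) => [k|]; last by rewrite g1x /in_label ?bx ?eqxx.
    have bgx : block z (g1 x) = Some k by rewrite g1b.
    rewrite (g1E _ _ bx); case: (ABP k) => [[j kE] _|]; last by rewrite eqxx.
    move: (bx) bgx; rewrite (g1E _ _ bx) ifT; last by apply/ABP; exists j.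
    rewrite kE !blockP // => /andP[h1 h2] /andP[h3 h4]; exists j.
    split; [apply: wlab|apply: wlab| |]; by rewrite /lo /hi; lra.
  apply: nP => [|x /g1D[j [bx _ h1 h2]]].
    by apply: block_autI => // x /g1D[j [bx bgx _ _]]; exists (e j).
  by exists (e j); rewrite h1 h2 ae; split=> //; apply: en0.
apply: (small_quot sK Kg1 ga); set g2 := rinv g1 \o g.
have g2a : aut g2 by apply/aut_comp/ga/aut_rinv.
have g2E x k : block z x = Some k -> g2 x = if AB k then x else g x.
  move=> bx; rewrite /g2 /=; apply: rinv_eq => //.
  case: ifP => ABk; first by rewrite (g1E _ _ bx) ABk.
  by have /gb bgx := bx; rewrite (g1E _ _ bgx) ABk.
have g2D x : g2 x != x -> exists2 j, (j0 <= j)%N & l j <= x < r j /\ l j <= g2 x < r j.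
  case bx: (block z x) => [k|]; last first.
    by rewrite /g2 /= nolab // (rinv_eq g1a (y := x) (x := x)) ?eqxx // g1x // /in_label bx.
  rewrite (g2E _ _ bx); case: (ABP k) => [|NAB gx]; first by rewrite eqxx.
  have [k' kk' /blockP-/(_ zd)] := gD _ gx; rewrite bx => -[kE]; subst k'.
  have kex : exists j, (k < (e j).*2.+2)%N by exists k; have := jle k; lia.
  case: (ex_minnP kex) => -[|j] kj jmin.
    by have := ele 0%N j0 isT; move: kj kk'; clearbody e; lia.
  have jj : (j0 <= j)%N.
    rewrite leqNgt; apply/negP => /ele; move: kj kk'; clearbody e; lia.
  have kj2 : ((e j).*2.+2 <= k)%N by rewrite leqNgt; apply/negP => /jmin; rewrite ltnn.
  have kne : k != (e j.+1).*2.+1 by apply/eqP => kE; apply: NAB; exists j.+1.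
  have lk : l j <= z k.+1 by apply: (@decreasing_le z) => //; lia.
  have kr : z k <= r j by apply: (@decreasing_le z).
  exists j => //; move: (bx); have /gb := bx; rewrite !blockP // => h1 h2.
  by split; lra.
apply: (small_conjV sK Ks g2a).
have ha : aut (s \o g2 \o rinv s).
  by apply: (aut_comp (aut_comp sa g2a)); apply: aut_rinv.
have hD x : (s \o g2 \o rinv s) x != x ->
    exists j, r j <= x < m j /\ r j <= s (g2 (rinv s x)) < m j.
  rewrite /= -{2}(autV sa x) (inj_eq (aut_inj sa)) => /g2D[j jj [h1 h2]].
  by exists j; rewrite -{1 2}(autV sa x); split; apply: sgap.
have rlab j x : r j <= x < m j -> block w x = Some (e j).
  by move=> rx; apply: wlab; have := mP j; move: rx; rewrite /r /lo /hi; lra.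
apply: nP => [|x /hD[j [h1 h2]]].
  by apply: block_autI => // x /hD[j [h1 h2]]; exists (e j); rewrite !(rlab j).
exists (e j); rewrite (rlab j) // ae; split=> //.
by have := mP j; move: h1; rewrite /r /lo /hi; lra.
Qed.

(** * Supports, and cutting at a fixed point *)

Definition fixes (F : seq rat) (g : rat -> rat) := {in F, forall x, g x = x}.

Definition supported (I : set rat) (g : rat -> rat) := forall x, g x != x -> I x.

Lemma supported_id I g x : supported I g -> ~ I x -> g x = x.
Proof. by move=> gI NI; apply/eqP/negPn/negP => /gI. Qed.

Lemma supported_image I g x : aut g -> supported I g -> I x -> I (g x).
Proof.
move=> ga gI Ix; have [->//|gx] := eqVneq (g x) x.
by apply: gI; rewrite (inj_eq (aut_inj ga)).
Qed.

Lemma supported_rinv I g : aut g -> supported I g -> supported I (rinv g).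
Proof. by move=> ga gI x gx; apply: gI; apply: contra_neq gx => /(rinv_eq ga). Qed.

Lemma supported_comp I g h : supported I g -> supported I h -> supported I (g \o h).
Proof.
move=> gI hI x /=; have [->|/hI//] := eqVneq (h x) x.
exact: gI.
Qed.

Lemma supported_fixl p q g : aut g -> supported [set x | p <= x < q] g -> g p = p.
Proof.
move=> ga gI; apply/eqP/negPn/negP => gp.
have gg : g (g p) != g p by rewrite (inj_eq (aut_inj ga)).
have := gI _ gg; have rg : g (rinv g p) != rinv g p.
  by rewrite autV //; apply: contra_neq gp => {1}->; rewrite autV.
have := gI _ rg; rewrite /= -(aut_le ga) autV //; lra.
Qed.

Definition cut_below (c : rat) (g : rat -> rat) x := if x < c then g x else x.
Definition cut_above (c : rat) (g : rat -> rat) x := if c <= x then g x else x.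

Lemma aut_cut_below c g : aut g -> g c = c -> aut (cut_below c g).
Proof.
move=> ga gc; pose b (x : rat) := if x < c then Some tt else None.
have bE x : b x = Some tt <-> x < c by rewrite /b; case: ifP.
rewrite (_ : cut_below c g = glue b (fun=> g)).
  apply: aut_glue => // -[] x; first by move=> y z xy yz /bE ? /bE ?; apply/bE; lra.
  by rewrite !bE -{1}gc aut_lt.
by apply/funext => x; rewrite /cut_below /glue /b; case: ifP.
Qed.

Lemma aut_cut_above c g : aut g -> g c = c -> aut (cut_above c g).
Proof.
move=> ga gc; pose b (x : rat) := if c <= x then Some tt else None.
have bE x : b x = Some tt <-> c <= x by rewrite /b; case: ifP.
rewrite (_ : cut_above c g = glue b (fun=> g)).
  apply: aut_glue => // -[] x; first by move=> y z xy yz /bE ? /bE ?; apply/bE; lra.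
  by rewrite !bE -{1}gc aut_le.
by apply/funext => x; rewrite /cut_above /glue /b; case: ifP.
Qed.

Lemma cut_comp c g : aut g -> g c = c -> g = cut_below c g \o cut_above c g.
Proof.
move=> ga gc; apply/funext => x; rewrite /cut_above /cut_below /=.
by case: (leP c x) => [cx|->//]; rewrite -{1}gc aut_lt // ltNge cx.
Qed.

Lemma small_cut K c g : small_index K -> aut g -> g c = c ->
  K (cut_below c g) -> K (cut_above c g) -> K g.
Proof. by move=> sK ga gc Kl Kr; rewrite (cut_comp ga gc); apply: small_comp. Qed.

Lemma cut_belowE c g x : (cut_below c g x != x) = (x < c) && (g x != x).
Proof. by rewrite /cut_below; case: ifP; rewrite ?eqxx. Qed.

Lemma cut_aboveE c g x : (cut_above c g x != x) = (c <= x) && (g x != x).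
Proof. by rewrite /cut_above; case: ifP; rewrite ?eqxx. Qed.

Lemma block_aut_fix z g k : decreasing z -> block_aut (block z) predT g -> g (z k) = z k.
Proof.
move=> zd [ga gb gT]; case: k => [|k].
  apply: gT; rewrite /in_label; case bz: (block _ _) => [k|//].
  by move/(blockP _ _ zd)/andP: bz => [_]; rewrite ltNge (decreasing_le zd).
have bz : block z (z k.+1) = Some k by apply/blockP => //; rewrite lexx zd.
have ge : z k.+1 <= g (z k.+1) by move: (gb (z k.+1)); rewrite bz => /(blockP _ _ zd)/andP[].
have : block z (rinv g (z k.+1)) = Some k by rewrite -gb autV.
by move=> /(blockP _ _ zd)/andP[]; rewrite -(aut_le ga) autV //; lra.
Qed.

(* An infinite product over blocks is split into a tail, handled by
   [tail_blocks], and a part with bounded support. *)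
Lemma coinitial_fix K z (u : nat -> nat) b : small_index K -> decreasing z ->
  (forall k g, aut g -> supported [set x | z k <= x < z 0%N] g -> K g) ->
  (forall i, u i < u i.+1)%N ->
  aut b -> (forall i, b (z (u i)) = z (u i)) ->
  supported [set x | x < z 0%N /\ exists k, z k <= x] b -> K b.
Proof.
move=> sK zd good us ba bu bD; pose y i := z (u i).
have ule i : (i <= u i)%N by elim: i => // i IH; apply: leq_ltn_trans IH (us i).
have yd : decreasing y by move=> i; apply: (@decreasing_lt z).
have [i0 i0P] := tail_blocks sK yd.
apply: (small_cut (c := y i0)) => //; first exact: bu.
  apply: i0P => [|k|x]; first by apply: aut_cut_below => //; apply: bu.
    by rewrite /cut_below; case: ifP => // _; apply: bu.
  rewrite cut_belowE => /andP[xi0 /bD[_ [k kx]]].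
  have ex : exists i, y i <= x by exists k; apply: le_trans kx; apply: (@decreasing_le z).
  case: (ex_minnP ex) => -[|i] yi imin.
    by have := decreasing_le yd (leq0n i0); lra.
  exists i; first by have := decreasing_ltP yd yi xi0.
  by rewrite yi ltNge; apply/negP => /imin; rewrite ltnn.
apply: (good (u i0)) => [|x]; first by apply: aut_cut_above => //; apply: bu.
by rewrite cut_aboveE => /andP[ix /bD[xz _]]; rewrite /= ix.
Qed.

(** The subsequence [u] is so sparse that [g] sends [z (u i.+1)] strictly between [z (u i.+2)] and
    [z (u i)]. Hence some [a] fixes the even terms and agrees with [g] on the odd ones; [a] and
    [rinv a \o g] each fix a subsequence, so [coinitial_fix] applies to both. *)
Lemma coinitial_small K z g : small_index K -> decreasing z ->
  (forall k g, aut g -> supported [set x | z k <= x < z 0%N] g -> K g) ->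
  aut g -> supported [set x | x < z 0%N /\ exists k, z k <= x] g -> K g.
Proof.
move=> sK zd good ga gD; set D := [set x | _] in gD.
have Dz m : z m.+1 \in D by rewrite inE; split; [apply: decreasing_lt|exists m.+1].
have below h m : aut h -> supported D h -> exists k, forall i, (k <= i)%N -> z i < h (z m).
  move=> ha hD; have [->|hm] := eqVneq (h (z m)) (z m).
    by exists m.+1 => i mi; apply: decreasing_lt.
  have /hD[_ [k kh]] : h (h (z m)) != h (z m) by rewrite (inj_eq (aut_inj ha)).
  by exists k.+1 => i ki; apply: lt_le_trans kh; apply: decreasing_lt.
have /choice[step stepP] m : exists k, [/\ (m < k)%N, z k < g (z m) & g (z k) < z m].
  have [k1 k1P] := below g m ga gD.
  have [k2 k2P] := below (rinv g) m (aut_rinv ga) (supported_rinv ga gD).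
  exists (maxn m.+1 (maxn k1 k2)); split; first exact: leq_maxl.
    by apply: k1P; rewrite !leq_max leqnn orbT.
  by rewrite -[z m](autV ga) aut_lt //; apply: k2P; rewrite !leq_max leqnn !orbT.
pose u i := iter i step 0%N.
have us i : (u i < u i.+1)%N by have [] := stepP (u i).
have u2 i : (u i.*2 < u i.+1.*2)%N by rewrite doubleS; apply: ltn_trans (us _) (us _).
have ud i : (u i.*2.+1 < u i.+1.*2.+1)%N by rewrite doubleS; apply: ltn_trans (us _) (us _).
pose y i := z (u i.*2); have yd : decreasing y by move=> i; apply: (@decreasing_lt z).
have [i|i|a aP aE] := @block_push y (fun i => z (u i.*2.+1)) (fun i => g (z (u i.*2.+1))) yd.
- by rewrite /y doubleS; apply/andP; split; apply: decreasing_lt.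
- by rewrite /y doubleS; have [_ -> _] := stepP (u i.*2.+1); have [_ _ ->] := stepP (u i.*2).
have [aa _ _] := aP.
have aD : supported D a.
  move=> x ax; case bx: (block y x) => [k|].
    move/(blockP _ _ yd)/andP: bx => [yx xy]; split; last by exists (u k.+1.*2).
    by apply: lt_le_trans xy _; apply: decreasing_le.
  by have [_ _ h] := aP; rewrite h ?eqxx // /in_label bx in ax.
have Ka : K a.
  by apply: (@coinitial_fix K z (fun i => u i.*2) a sK zd good u2) => // i; apply: (block_aut_fix _ yd aP).
apply: (small_quot sK Ka ga); apply: (@coinitial_fix K z (fun i => u i.*2.+1) _ sK zd good ud).
- by apply: aut_comp ga; apply: aut_rinv.
- by move=> i; rewrite /= -aE autK.
- by apply: supported_comp => //; apply: supported_rinv.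
Qed.

(** * The small index property for the order of the rationals *)

(** The pointwise closure of [K] contains the pointwise stabilizer of [F]. *)
Definition dense_in (K : set (rat -> rat)) (F : seq rat) :=
  forall g (E : seq rat), aut g -> fixes F g -> exists2 k, K k & {in E, k =1 g}.

(* Otherwise one builds, by finite approximations, an automorphism avoiding all
   the cosets of [K]. *)
Lemma small_dense K : small_index K -> exists F, dense_in K F.
Proof.
move=> sK; apply: contrapT => /forallNP N.
have /choice[GE GEP] F : exists ge : (rat -> rat) * seq rat,
    [/\ aut ge.1, fixes F ge.1 & forall k, K k -> ~ {in ge.2, k =1 ge.1}].
  apply: contrapT => N'; apply: (N F) => g E ga gF; apply: contrapT => N''.
  by apply: N'; exists (g, E); split=> // k Kk kg; apply: N''; exists k.
have [kappa [c [ca ck]]] := small_reps sK aut_id (fun g (h : aut g) => h).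
pose good n (sF sF' : (rat -> rat) * seq rat) :=
  [/\ aut sF'.1, {in sF.2, sF'.1 =1 sF.1}, {subset sF.2 <= sF'.2} &
    (forall q, unpickle n = Some q -> q \in sF'.2 /\ rinv sF'.1 q \in sF'.2) /\
    forall h, aut h -> {in sF'.2, h =1 sF'.1} -> ~ K (rinv (c n) \o h)].
have /choice[step stepP] (p : nat * ((rat -> rat) * seq rat)) :
    exists sF', aut p.2.1 -> good p.1 p.2 sF'.
  case: p => n [s F] /=.
  have [sa|] := pselect (aut s); last by exists (s, F).
  have [s' [F' [sa' ss' FF' hK]]] : exists s' (F' : seq rat), [/\ aut s', {in F, s' =1 s},
      {subset F <= F'} & forall h, aut h -> {in F', h =1 s'} -> ~ K (rinv (c n) \o h)].
    have [Ga GF NK] := GEP F; move: Ga GF NK; case: (GE F) => g E /= Ga GF NK.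
    (* If coset [n] has an element agreeing with [s] on [F], it is composed with the map of [GE F],
       which fixes [F] and which no element of [K] approximates; otherwise [s] already avoids that
       coset. *)
    have [[k Kk ks]|Nk] := pselect (exists2 k, K k & {in F, c n \o k =1 s}); last first.
      by exists s, F; split=> // h _ hs Kh; apply: Nk; exists (rinv (c n) \o h) => // x /hs /= <-; rewrite autV.
    have ka := small_aut sK Kk.
    exists (c n \o k \o g), (F ++ E); split.
    - by apply: (aut_comp (aut_comp (ca n) ka) Ga).
    - by move=> x xF; rewrite -(ks _ xF) /= GF.
    - by move=> x xF; rewrite mem_cat xF.
    move=> h ha hs Kh; apply: (NK _ (small_comp sK (small_rinv sK Kk) Kh)) => x xE.
    by rewrite /= hs ?mem_cat ?xE ?orbT //= !autK.
  (* Recording [q] and its preimage makes the limit total and surjective; the default only adds a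
     harmless point. *)
  pose q := odflt 0 (unpickle n : option rat).
  exists (s', [:: q, rinv s' q & F']) => _; split=> //=.
    by move=> x /FF' xF; rewrite !inE xF !orbT.
  split=> [r rn|h ha hs]; first by rewrite /q rn /= !inE !eqxx orbT.
  by apply: hK => // x xF; apply: hs; rewrite !inE xF !orbT.
pose S := fix S n := if n is n'.+1 then step (n', S n') else (id, [::]).
have Sa n : aut (S n).1.
  elim: n => [|n IH]; first exact: aut_id.
  by have [] := stepP (n, S n) IH.
have SP n : good n (S n) (S n.+1) by apply: (stepP (n, S n)); apply: Sa.
have SS m n : (m <= n)%N -> {subset (S m).2 <= (S n).2} /\ {in (S m).2, (S n).1 =1 (S m).1}.
  elim: n => [|n IH]; first by rewrite leqn0 => /eqP->; split=> x.
  rewrite leq_eqVlt => /predU1P[->|/IH[sub eq]]; first by split=> x.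
  have [_ e' sub' _] := SP n.
  by split=> x xm; [apply/sub'/sub|rewrite e' ?eq //; apply: sub].
have Sx x : x \in (S (pickle x).+1).2.
  by have [_ _ _ [/(_ x) []]] := SP (pickle x); rewrite ?pickleK.
pose h x := (S (pickle x).+1).1 x.
have hE n x : x \in (S n).2 -> h x = (S n).1 x.
  move=> xn; have [_ e1] := SS _ _ (leq_maxl n (pickle x).+1).
  by have [_ e2] := SS _ _ (leq_maxr n (pickle x).+1); rewrite -e1 // e2.
have ha : aut h.
  split=> [x y|y]; last first.
    have [_ _ _ [/(_ y)]] := SP (pickle y); rewrite pickleK => -[]// _ ry _.
    by exists (rinv (S (pickle y).+1).1 y); rewrite (hE _ _ ry) autV.
  have [sx _] := SS _ _ (leq_maxl (pickle x).+1 (pickle y).+1).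
  have [sy _] := SS _ _ (leq_maxr (pickle x).+1 (pickle y).+1).
  by rewrite (hE _ _ (sx _ (Sx x))) (hE _ _ (sy _ (Sx y))) aut_lt.
have [_ _ _ [_ NK]] := SP (kappa h).
by apply: (NK _ ha) (ck _ ha) => x /hE.
Qed.

Lemma small_supported0 K I g : small_index K -> supported I g -> (forall x, ~ I x) -> K g.
Proof.
move=> sK gI NI; rewrite (_ : g = id); first exact: small_id.
by apply/funext => x; apply: supported_id gI (NI x).
Qed.

(* Density conjugates any interval missing [F] to the one provided by
   [tail_blocks]. *)
Lemma dense_interval K F x y g : small_index K -> dense_in K F ->
  (forall f, f \in F -> ~ x <= f <= y) ->
  aut g -> supported [set t | x <= t < y] g -> K g.
Proof.
move=> sK dK NF ga gI.
have [yx|xy] := leP y x; first by apply: (small_supported0 sK gI) => t /=; lra.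
(* The sequence runs from [y] down towards [x] without meeting [F], so an automorphism fixing [F]
   can stretch one of its intervals onto the whole. *)
pose z k : rat := x + (y - x) / k.+1%:R.
have zd : decreasing z.
  move=> k; rewrite /z ltrD2l ltr_pM2l ?subr_gt0 // ltf_pV2 ?posrE ?ltr0Sn //.
  by rewrite ltr_nat.
have zx k : x < z k by rewrite /z ltrDl divr_gt0 ?subr_gt0 ?ltr0Sn.
have zy k : z k <= y by apply: le_trans (decreasing_le zd (leq0n k)) _; rewrite /z divr1; lra.
have [k0 k0P] := tail_blocks sK zd.
pose p := z k0.+1; pose q := z k0.
have Kpq h : aut h -> supported [set t | p <= t < q] h -> K h.
  move=> ha hI; apply: k0P => // [k|t /hI ht]; last by exists k0.
  have [kk|] := leqP k k0.
    by apply: (supported_id hI) => /=; have := decreasing_le zd kk; rewrite /q; lra.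
  rewrite leq_eqVlt => /predU1P[<-|kk]; first exact: supported_fixl hI.
  by apply: (supported_id hI) => /=; have := decreasing_lt zd kk; rewrite /p; lra.
have pq : p < q by apply: zd.
have [||t ta tP] := @aut_extend ((p, x) :: (q, y) :: [seq (f, f) | f <- F]).
- move=> u v /[!inE] /or3P[/eqP->|/eqP->|/mapP[f fF ->]] /or3P[/eqP->|/eqP->|/mapP[f' fF' ->]] //=;
    rewrite ?ltxx //; try (have := NF _ fF); try (have := NF _ fF');
    have := zx k0; have := zx k0.+1; have := zy k0; have := zy k0.+1; rewrite -/p -/q; lra.
- move=> u v /[!inE] /or3P[/eqP->|/eqP->|/mapP[f fF ->]] /or3P[/eqP->|/eqP->|/mapP[f' fF' ->]] //=;
    rewrite ?ltxx //; try (have := NF _ fF); try (have := NF _ fF');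
    have := zx k0; have := zx k0.+1; have := zy k0; have := zy k0.+1; rewrite -/p -/q; lra.
have tF : fixes F t.
  by move=> f fF; apply: (tP (f, f)); rewrite !inE (map_f (fun f => (f, f))) ?orbT.
have [k Kk kt] := dK t [:: p; q] ta tF; have ka := small_aut sK Kk.
have kp : k p = x by rewrite kt ?mem_head //; apply: (tP (p, x)); rewrite mem_head.
have kq : k q = y.
  by rewrite kt ?inE ?eqxx ?orbT //; apply: (tP (q, y)); rewrite !inE eqxx orbT.
apply: (small_conj sK Kk ga); apply: Kpq => [|u] /=.
  by apply: (aut_comp (aut_comp (aut_rinv ka) ga) ka).
rewrite -{2}(autK ka u) (inj_eq (aut_inj (aut_rinv ka))) => /gI /=.
by rewrite -kp -kq (aut_le ka) (aut_lt ka).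
Qed.

Lemma coinitial_seq (I : set rat) p : I p -> (forall x, I x -> exists2 y, I y & y < x) ->
  exists z, [/\ decreasing z, z 0%N = p, forall k, I (z k) & forall x, I x -> exists k, z k <= x].
Proof.
move=> Ip Iopen.
have /choice[step stepP] (nz : nat * rat) : exists y, I nz.2 ->
    [/\ I y, y < nz.2 & forall q : rat, unpickle nz.1 = Some q -> I q -> y <= q].
  case: nz => n z /=; have [Iz|] := pselect (I z); last by exists z.
  have [y Iy yz] := Iopen _ Iz; case: (@unpickle rat n) => [q|]; last by exists y.
  have [Iq|NIq] := pselect (I q); last by exists y => _; split=> // r [<-].
  have [yq|qy] := leP y q; first by exists y => _; split=> // r [<-].
  by exists q => _; split=> // [|r [<-]//]; apply: lt_trans yz.
pose z := fix z n := if n is n'.+1 then step (n', z n') else p.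
have zI n : I (z n) by elim: n => // n IH; have [] := stepP (n, z n) IH.
exists z; split=> // [n|x Ix]; first by have [] := stepP (n, z n) (zI n).
exists (pickle x).+1; have [_ _] := stepP (pickle x, z (pickle x)) (zI _).
by apply; rewrite ?pickleK.
Qed.

Definition convex_set (I : set rat) := forall x y z, x < y -> y < z -> I x -> I z -> I y.

Definition open_ends (I : set rat) :=
  forall x, I x -> (exists2 y, I y & y < x) /\ (exists2 y, I y & x < y).

(** The ends of [I] may be irrational cuts, so intervals with rational ends only exhaust [I]. Once
    [g] is corrected by [t1] to fix a point [p], its parts below and above [p] are treated along
    sequences tending to the two ends, the upper one after reflection. *)
Lemma dense_component K F I g : small_index K -> dense_in K F ->
  convex_set I -> open_ends I -> (forall f, f \in F -> ~ I f) ->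
  aut g -> supported I g -> K g.
Proof.
move=> sK dK Ic Io NF ga gI.
have [[p Ip]|NI] := pselect (exists p, I p); last first.
  by apply: (small_supported0 sK gI) => x Ix; apply: NI; exists x.
have Kint x y h : I x -> I y -> aut h -> supported [set t | x <= t < y] h -> K h.
  move=> Ix Iy; apply: (dense_interval sK dK) => f fF /andP[xf fy]; apply: (NF _ fF).
  case: (ltgtP x f) xf => // [xf _|<-//]; case: (ltgtP f y) fy => // [fy _|->//].
  exact: Ic xf fy Ix Iy.
have Igp := supported_image ga gI Ip.
have [x [Ix xp xgp]] : exists x, [/\ I x, x < p & x < g p].
  have [[x Ix xp] _] := Io _ Ip; have [[y Iy yp] _] := Io _ Igp.
  by have [xy|yx] := leP x y; [exists x|exists y]; split=> //; lra.
have [y [Iy py gpy]] : exists y, [/\ I y, p < y & g p < y].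
  have [_ [x' Ix' xp']] := Io _ Ip; have [_ [y Iy yp]] := Io _ Igp.
  by have [xy|yx] := leP x' y; [exists y|exists x']; split=> //; lra.
have [|t ta tP] := @aut_extend_sorted [:: (x, x); (p, g p); (y, y)].
  by rewrite /= xp py xgp gpy.
have tx : t x = x by apply: (tP (_, _)); rewrite mem_head.
have tp : t p = g p by apply: (tP (p, _)); rewrite !inE eqxx orbT.
have ty : t y = y by apply: (tP (_, _)); rewrite !inE eqxx !orbT.
pose t1 := cut_below y (cut_above x t).
have t1a : aut t1.
  by apply: aut_cut_below; [apply: aut_cut_above|rewrite /cut_above ty; case: ifP].
have t1I : supported [set u | x <= u < y] t1.
  by move=> u; rewrite cut_belowE cut_aboveE => /= /and3P[-> -> _].
have t1p : t1 p = g p by rewrite /t1 /cut_below /cut_above py (ltW xp).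
apply: (small_quot sK (Kint x y t1 Ix Iy t1a t1I) ga).
set h := rinv t1 \o g; have ha : aut h by apply/aut_comp/ga/aut_rinv.
have hp : h p = p by rewrite /h /= -t1p autK.
have hI : supported I h.
  apply: supported_comp => //; apply: supported_rinv => // u /t1I /= /andP[xu uy].
  case: (ltgtP x u) xu => // [xu _|<-//]; exact: Ic xu uy Ix Iy.
apply: (small_cut (c := p)) => //.
  have [z [zd z0 zI zco]] := coinitial_seq Ip (fun x Ix => (Io x Ix).1).
  apply: (coinitial_small sK zd) => [k g' g'a||u].
  - by rewrite z0; apply: Kint.
  - exact: aut_cut_below.
  - by rewrite cut_belowE => /andP[up /hI /zco ex]; rewrite /= z0.
pose I' := [set u | I (- u)].
have [|u Iu|z [zd z0 zI zco]] := @coinitial_seq I' (- p).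
- by rewrite /I' /= opprK.
- have [_ [v Iv uv]] := Io _ Iu; exists (- v); rewrite /I' /= ?opprK //; lra.
have [_ [p' Ip' pp']] := Io _ Ip.
have hua : aut (cut_above p h) by apply: aut_cut_above.
rewrite -[cut_above p h]opp_conjK.
apply: (coinitial_small (small_opp_conj sK) zd) => [k g' g'a g'I||u] /=.
(* Reflection puts the closed end of the interval on top, so a larger point of [I] is needed as
   strict bound. *)
- have [_ [v Iv uv]] := Io _ (zI k).
  apply: (Kint p v) => // [|u gu]; first exact: aut_opp_conj.
  have /g'I : g' (- u) != - u by apply: contra_neq gu; rewrite /opp_conj => ->; rewrite opprK.
  by rewrite z0 /=; lra.
- exact: aut_opp_conj.
rewrite /opp_conj eqr_oppLR cut_aboveE z0 => /andP[pu hu].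
have {}pu : p < - u.
  by move: pu; rewrite le_eqVlt => /predU1P[pu|//]; rewrite -pu hp eqxx in hu.
split; first by lra.
by apply: zco; rewrite /I' /=; apply: hI.
Qed.

(** Cutting at a point of [F] inside [I], which [g] fixes, leaves two smaller convex sets with open
    ends; when no such point remains, [dense_component] applies. *)
Theorem small_index_property K : small_index K ->
  exists F : seq rat, forall g, aut g -> fixes F g -> K g.
Proof.
move=> sK; have [F dK] := small_dense sK; exists F.
suff main (s : seq rat) : forall I : set rat, convex_set I -> open_ends I ->
    (forall f, f \in F -> I f -> f \in s) ->
    forall g, aut g -> fixes F g -> supported I g -> K g.
  move=> g ga gF; apply: (main F setT) => // x _; split.
    by exists (x - 1) => //; lra.
  by exists (x + 1) => //; lra.
elim: s => [|c s IH] I Ic Io Fs g ga gF gI.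
  by apply: (dense_component sK dK Ic Io) => // f fF /(Fs _ fF).
have [[Ixc cF]|N] := pselect (I c /\ c \in F); last first.
  apply: (IH I) => // f fF If; have := Fs _ fF If; rewrite inE => /predU1P[fc|//].
  by case: N; rewrite -fc.
have gc := gF _ cF.
apply: (small_cut sK ga gc).
  apply: (IH [set x | I x /\ x < c]) => [x y z xy yz [Ix _] [Iz zc]|x [Ix xc]|f fF [If fc]| |f fF|x].
  - by split; [apply: Ic xy yz Ix Iz|lra].
  - have [[y Iy yx] _] := Io _ Ix; split; first by exists y => //; split=> //; lra.
    exists ((x + c) / 2%:R); last by lra.
    by split; [apply: (Ic x _ c) => //|]; lra.
  - by have := Fs _ fF If; rewrite inE => /predU1P[fc'|//]; rewrite fc' ltxx in fc.
  - exact: aut_cut_below.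
  - by rewrite /cut_below gF //; case: ifP.
  - by rewrite cut_belowE => /andP[xc /gI].
apply: (IH [set x | I x /\ c < x]) => [x y z xy yz [Ix cx] [Iz _]|x [Ix xc]|f fF [If fc]| |f fF|x].
- by split; [apply: Ic xy yz Ix Iz|lra].
- have [_ [y Iy yx]] := Io _ Ix; split; last by exists y => //; split=> //; lra.
  exists ((x + c) / 2%:R); last by lra.
  by split; [apply: (Ic c _ x) => //|]; lra.
- by have := Fs _ fF If; rewrite inE => /predU1P[fc'|//]; rewrite fc' ltxx in fc.
- exact: aut_cut_above.
- by rewrite /cut_above gF //; case: ifP.
- rewrite cut_aboveE le_eqVlt => /andP[/predU1P[<-|cx gx]]; first by rewrite gc eqxx.
  by split=> //; apply: gI.
Qed.

(** * The cyclic order and the circle cut at a point *)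

Definition cyc (x y z : rat) : bool := [|| x < y < z, y < z < x | z < x < y].

Lemma cyc_rot x y z : cyc y z x = cyc x y z.
Proof. by rewrite /cyc orbA orbC. Qed.

Lemma cycxx x y : cyc x x y = false.
Proof. by apply/negP; rewrite /cyc; lra. Qed.

Lemma cycxyx x y : cyc x y x = false.
Proof. by rewrite cyc_rot cycxx. Qed.

Lemma cycxyy x y : cyc x y y = false.
Proof. by rewrite -cyc_rot cycxx. Qed.

Lemma circE x y z : circ x y z = [|| x == y, y == z, z == x | cyc x y z].
Proof. by apply/idP/idP; rewrite /circ /cyc; lra. Qed.

Lemma cycN x y z : cyc (- x) (- y) (- z) = cyc x z y.
Proof. by apply/idP/idP; rewrite /cyc; lra. Qed.

Lemma cycD x y z c : cyc (x + c) (y + c) (z + c) = cyc x y z.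
Proof. by rewrite /cyc !ltrD2r. Qed.

Lemma cyc_cut0 x y z : x != 0 -> y != 0 -> z != 0 ->
  cyc x y z = [|| cyc 0 x y && cyc 0 y z, cyc 0 y z && cyc 0 z x | cyc 0 z x && cyc 0 x y].
Proof.
by rewrite !neq_lt => /orP[]x0 /orP[]y0 /orP[]z0; apply/idP/idP; rewrite /cyc; lra.
Qed.

(** Seen from [0], all positive numbers precede all negative ones; hence the witnesses [x + 1], [1]
    and [- 1]. *)
Lemma punctured_dense_order :
  dense_order (fun u v : {x : rat | x != 0} => cyc 0 (val u) (val v)).
Proof.
split.
- by move=> u; rewrite cycxyy.
- by move=> [y y0] [x x0] [z z0] /=; rewrite /cyc; lra.
- by move=> [x x0] [y y0]; rewrite -val_eqE /=; move: x0 y0; rewrite /cyc !neq_lt; lra.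
- move=> [x x0] [y y0] /=.
  have sub (z : rat) : z != 0 -> cyc 0 x z -> cyc 0 z y ->
      exists2 u : {x : rat | x != 0}, cyc 0 x (val u) & cyc 0 (val u) y.
    by move=> z0; exists (exist _ z z0).
  move=> xy; have [s|s] : x < y \/ y < x by move: xy; rewrite /cyc; lra.
    by apply: (sub ((x + y) / 2%:R)); move: xy; rewrite /cyc ?neq_lt; lra.
  by apply: (sub (x + 1)); move: xy; rewrite /cyc ?neq_lt; lra.
- move=> [x x0]; have sub (z : rat) : z != 0 -> cyc 0 z x ->
      exists u : {x : rat | x != 0}, cyc 0 (val u) x by move=> z0; exists (exist _ z z0).
  have /orP[s|s] : (x < 0) || (0 < x) by rewrite -neq_lt.
    by apply: (sub 1); rewrite /cyc; lra.
  by apply: (sub (x / 2%:R)); rewrite /cyc ?neq_lt; lra.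
- move=> [x x0]; have sub (z : rat) : z != 0 -> cyc 0 x z ->
      exists u : {x : rat | x != 0}, cyc 0 x (val u) by move=> z0; exists (exist _ z z0).
  have /orP[s|s] : (x < 0) || (0 < x) by rewrite -neq_lt.
    by apply: (sub (x / 2%:R)); rewrite /cyc ?neq_lt; lra.
  by apply: (sub (- 1)); rewrite /cyc; lra.
- by exists (exist _ 1 isT).
Qed.

Lemma beta_exists : exists bb : (rat -> rat) * (rat -> rat),
  [/\ forall x, bb.1 x != 0, cancel bb.1 bb.2, forall y, y != 0 -> bb.1 (bb.2 y) = y &
    forall x y, cyc 0 (bb.1 x) (bb.1 y) = (x < y)].
Proof.
have [|f [g [fK gK fm _]]] := @back_and_forth _ _ _ _ [::] rat_dense_order punctured_dense_order.
  by [].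
exists (fun x => val (f x), fun y => if insub y is Some u then g u else 0); split=> /= [x|x|y y0|//].
- exact: (valP (f x)).
- by rewrite valK fK.
- by rewrite insubT gK.
Qed.

(* [beta] identifies the order of [rat] with the linear order obtained by
   cutting the circle at [0]. *)
Definition beta := (projT1 (cid beta_exists)).1.
Definition beta' := (projT1 (cid beta_exists)).2.

Lemma beta_neq0 x : beta x != 0.
Proof. by rewrite /beta; case: (cid _) => bb p /=; case: p => [h _ _ _]; apply: h. Qed.

Lemma betaK : cancel beta beta'.
Proof. by rewrite /beta /beta'; case: (cid _) => bb p /=; case: p => [_ h _ _]. Qed.

Lemma beta'K y : y != 0 -> beta (beta' y) = y.
Proof. by rewrite /beta /beta'; case: (cid _) => bb p /=; case: p => [_ _ h _]; apply: h. Qed.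

Lemma cyc0_beta x y : cyc 0 (beta x) (beta y) = (x < y).
Proof. by rewrite /beta; case: (cid _) => bb p /=; case: p => [_ _ _ h]; apply: h. Qed.

Lemma beta_inj : injective beta. Proof. exact: can_inj betaK. Qed.

Lemma cyc_beta x y z : cyc (beta x) (beta y) (beta z) = cyc x y z.
Proof.
by rewrite cyc_cut0 ?beta_neq0 // !cyc0_beta.
Qed.

Variant beta_spec : rat -> Type :=
  | BetaZero : beta_spec 0
  | BetaOf u : beta_spec (beta u).

Lemma betaP x : beta_spec x.
Proof.
have [->|x0] := eqVneq x 0; first exact: BetaZero.
by rewrite -(beta'K x0); apply: BetaOf.
Qed.

Definition lift (h : rat -> rat) (x : rat) : rat := if x == 0 then 0 else beta (h (beta' x)).

Lemma lift0 h : lift h 0 = 0. Proof. by rewrite /lift eqxx. Qed.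

Lemma lift_beta h x : lift h (beta x) = beta (h x).
Proof. by rewrite /lift (negPf (beta_neq0 x)) betaK. Qed.

Lemma lift_comp f g : lift (f \o g) = lift f \o lift g.
Proof. by apply/funext => x /=; case: (betaP x) => [|u]; rewrite ?lift0 ?lift_beta. Qed.

Lemma lift_id : lift id = id.
Proof. by apply/funext => x /=; case: (betaP x) => [|u]; rewrite ?lift0 ?lift_beta. Qed.

Lemma cyc_lift h x y z : {mono h : x y / x < y} ->
  cyc (lift h x) (lift h y) (lift h z) = cyc x y z.
Proof.
move=> hm; have c0 u v : cyc 0 (beta (h u)) (beta (h v)) = cyc 0 (beta u) (beta v).
  by rewrite !cyc0_beta hm.
case: (betaP x) => [|u]; case: (betaP y) => [|v]; case: (betaP z) => [|w];
  rewrite ?lift0 ?lift_beta ?cycxx ?cycxyx ?cycxyy //.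
- by rewrite -!(cyc_rot _ 0) c0.
- by rewrite !(cyc_rot 0) c0.
- by rewrite !cyc_beta /cyc !hm.
Qed.

(** * Normal form of the embeddings and automorphisms *)

Lemma cyc_embedding f : injective f -> (forall x y z, cyc (f x) (f y) (f z) = cyc x y z) ->
  sep_embedding f.
Proof.
move=> fI fc; split=> // x y z t.
suff cE a b c : circ (f a) (f b) (f c) = circ a b c by rewrite /sep !cE.
by rewrite !circE fc !(inj_eq fI).
Qed.

Lemma lift_inj h : injective h -> injective (lift h).
Proof.
move=> hI x y; case: (betaP x) => [|u]; case: (betaP y) => [|v];
  rewrite ?lift0 ?lift_beta // => e; [| |by have /hI-> := beta_inj e].
- by have := beta_neq0 (h v); rewrite -e eqxx.
- by have := beta_neq0 (h u); rewrite e eqxx.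
Qed.

Lemma sep_embedding_id : sep_embedding id. Proof. by split. Qed.

Lemma sep_embedding_comp f g : sep_embedding f -> sep_embedding g -> sep_embedding (f \o g).
Proof. by move=> [fI fS] [gI gS]; split=> [x y /fI/gI//|x y z t /gS/fS]. Qed.

Lemma sep_embedding_lift h : {mono h : x y / x < y} -> sep_embedding (lift h).
Proof.
move=> hm; apply: cyc_embedding => [|x y z]; last exact: cyc_lift.
exact/lift_inj/mono_rat_inj.
Qed.

Lemma sep_embedding_shift c : sep_embedding (fun x => x + c).
Proof. by apply: cyc_embedding => [x y /addIr//|x y z]; apply: cycD. Qed.

Lemma sep_embedding_opp : sep_embedding (fun x => - x).
Proof.
split=> [|x y z t]; first exact: oppr_inj.
have cE a b c : circ (- a) (- b) (- c) = circ a c b.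
  rewrite !circE cycN !eqr_opp (eq_sym a c) (eq_sym c b) (eq_sym b a).
  by case: (a == b) (b == c) (c == a) => [] [] [].
by rewrite /sep !cE orbC.
Qed.

(** The directions of [f] on two pairs are compared through a point below both. *)
Lemma between_monotone (f : rat -> rat) : injective f ->
  (forall x y z, x < y -> y < z -> (f x < f y < f z) || (f z < f y < f x)) ->
  {mono f : x y / x < y} \/ {mono f : x y / x < y >-> y < x}.
Proof.
move=> fI fb.
have s3 x y z : x < y -> y < z -> (f x < f y) = (f x < f z) /\ (f y < f z) = (f x < f z).
  by move=> xy yz; have := fb _ _ _ xy yz; split; apply/idP/idP; lra.
have same x y x' y' : x < y -> x' < y' -> (f x < f y) = (f x' < f y').
  move=> xy xy'; have [m [mx mx']] : exists m, m < x /\ m < x'.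
    by have [xx|xx] := leP x x'; [exists (x - 1)|exists (x' - 1)]; lra.
  have [a b] := s3 _ _ _ mx xy; have [c d] := s3 _ _ _ mx' xy'.
  rewrite b -a d -c; case: (ltgtP x x') => [xx|xx|->//].
    by have [] := s3 _ _ _ mx xx.
  by have [] := s3 _ _ _ mx' xx.
have [up|dn] := boolP (f 0 < f 1).
  left=> x y; have h u v : u < v -> f u < f v by move=> uv; rewrite (same _ _ 0 1) //.
  by apply/idP/idP => [|/h//]; case: (ltgtP x y) => // [/h|->]; lra.
right=> x y; have h u v : u < v -> f v < f u.
  move=> uv; rewrite lt_neqAle (inj_eq fI) gt_eqF //= leNgt.
  by rewrite (same _ _ 0 1).
by apply/idP/idP => [|/h//]; case: (ltgtP y x) => // [/h|->]; lra.
Qed.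

(** An orientation preserving embedding fixing [0], then a reflection if [e], then the translation
    giving the value [c] at [0]. *)
Definition std (c : rat) (e : bool) (h : rat -> rat) (x : rat) : rat :=
  (if e then - lift h x else lift h x) + c.

Lemma sep_embedding_std c e h : {mono h : x y / x < y} -> sep_embedding (std c e h).
Proof.
move=> hm; apply: (sep_embedding_comp (sep_embedding_shift c)).
case: e; last exact: sep_embedding_lift.
exact: (sep_embedding_comp sep_embedding_opp (sep_embedding_lift hm)).
Qed.

Definition unlift (f : rat -> rat) (u : rat) : rat := beta' (f (beta u)).

Lemma sep_embedding_between f x y z : sep_embedding f -> f 0 = 0 -> x < y -> y < z ->
  (unlift f x < unlift f y < unlift f z) || (unlift f z < unlift f y < unlift f x).
Proof.
move=> [fI fS] f0 xy yz; set g := unlift f.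
have fb u : f (beta u) = beta (g u).
  by rewrite /g /unlift beta'K // -f0 (inj_eq fI) beta_neq0.
have gI : injective g by move=> u v /(congr1 beta); rewrite -!fb => /fI/beta_inj.
have c0 u v : circ 0 (beta u) (beta v) = (u <= v).
  rewrite circE cyc0_beta le_eqVlt (inj_eq beta_inj) [0 == _]eq_sym.
  by rewrite (negPf (beta_neq0 u)) (negPf (beta_neq0 v)).
(* The chord from [0] to [beta y] separates the other two points: on the line cut at [0], this is
   betweenness. *)
have := fS 0 (beta y) (beta z) (beta x).
rewrite /sep f0 !fb !c0 (ltW xy) (ltW yz) => /(_ isT).
have : g x != g y by rewrite (inj_eq gI) lt_eqF.
have : g y != g z by rewrite (inj_eq gI) lt_eqF.
by rewrite !neq_lt; lra.
Qed.

Theorem sep_embedding_stdE f : sep_embedding f ->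
  exists c e h, {mono h : x y / x < y} /\ f = std c e h.
Proof.
move=> fE; pose f1 x := f x + - f 0.
have f1E : sep_embedding f1 by apply: (sep_embedding_comp (sep_embedding_shift _) fE).
have f10 : f1 0 = 0 by rewrite /f1 subrr.
have fb g u : sep_embedding g -> g 0 = 0 -> g (beta u) = beta (unlift g u).
  by move=> [gI _] g0; rewrite /unlift beta'K // -g0 (inj_eq gI) beta_neq0.
have lP g : sep_embedding g -> g 0 = 0 -> g = lift (unlift g).
  move=> gE g0; apply/funext => x; case: (betaP x) => [|u]; first by rewrite g0 lift0.
  by rewrite lift_beta -fb.
have gI g : sep_embedding g -> g 0 = 0 -> injective (unlift g).
  by move=> gE g0 u v /(congr1 beta); rewrite -!fb // => /(proj1 gE)/beta_inj.
have [up|dn] := between_monotone (gI _ f1E f10)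
    (fun x y z xy yz => sep_embedding_between f1E f10 xy yz).
  exists (f 0), false, (unlift f1); split=> //.
  by apply/funext => x; rewrite /std -lP // /f1 subrK.
pose f2 x := - f1 x.
have f2E : sep_embedding f2 := sep_embedding_comp sep_embedding_opp f1E.
have f20 : f2 0 = 0 by rewrite /f2 f10 oppr0.
exists (f 0), true, (unlift f2); split=> [x y|].
  rewrite -(dn x y) -!cyc0_beta -(fb f2) // -(fb f2) // -(fb f1) // -(fb f1) //.
  by rewrite -{1}oppr0 cycN.
by apply/funext => x; rewrite /std -lP // /f2 /f1 opprK subrK.
Qed.

Definition sep_aut (f : rat -> rat) := sep_embedding f /\ forall y, exists x, f x = y.

Lemma sep_autE f : sep_aut f -> exists c e h, aut h /\ f = std c e h.
Proof.
move=> [/sep_embedding_stdE[c [e [h [hm ->]]]] fs]; exists c, e, h; split=> //; split=> // y.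
have [x xy] := fs ((if e then - beta y else beta y) + c).
have ly : lift h x = beta y.
  by move: xy => /addIr; case: (e) => // /oppr_inj.
case: (betaP x) ly => [|u]; first by rewrite lift0 => e0; have := beta_neq0 y; rewrite -e0 eqxx.
by rewrite lift_beta => /beta_inj; exists u.
Qed.

Lemma lift_rinvK h : aut h -> cancel (lift h) (lift (rinv h)).
Proof. by move=> ha x; case: (betaP x) => [|u]; rewrite ?lift0 ?lift_beta ?autK. Qed.

Lemma rinvK h : aut h -> rinv (rinv h) = h.
Proof.
by move=> ha; apply/funext => x; apply: rinv_eq; [apply: aut_rinv|rewrite autK].
Qed.

Lemma lift_rinvVK h : aut h -> cancel (lift (rinv h)) (lift h).
Proof. by move=> ha; rewrite -{2}(rinvK ha); apply/lift_rinvK/aut_rinv. Qed.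

Lemma sep_aut_std c e h : aut h -> sep_aut (std c e h).
Proof.
move=> ha; split=> [|y]; first by apply: sep_embedding_std; apply: aut_lt.
exists (lift (rinv h) (if e then - (y - c) else y - c)).
by rewrite /std lift_rinvVK //; case: e; rewrite ?opprK subrK.
Qed.

Lemma sep_aut_lift h : aut h -> sep_aut (lift h).
Proof.
move=> ha; rewrite (_ : lift h = std 0 false h); first exact: sep_aut_std.
by apply/funext => x; rewrite /std addr0.
Qed.

Lemma sep_aut_shift c : sep_aut (fun x => x + c).
Proof. by split=> [|y]; [apply: sep_embedding_shift|exists (y - c); rewrite subrK]. Qed.

Lemma sep_aut_id : sep_aut id.
Proof. by split=> [|y]; [apply: sep_embedding_id|exists y]. Qed.

Lemma sep_aut_comp f g : sep_aut f -> sep_aut g -> sep_aut (f \o g).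
Proof.
move=> [fE fs] [gE gs]; split=> [|z]; first exact: sep_embedding_comp.
by have [y <-] := fs z; have [x <-] := gs y; exists x.
Qed.

Lemma sep_aut_inv f : sep_aut f -> exists g, [/\ sep_aut g, cancel f g & cancel g f].
Proof.
move=> /sep_autE[c [e [h [ha ->]]]].
pose n x : rat := if e then - x else x.
have nA : sep_aut n.
  rewrite /n; case: e {n}; last exact: sep_aut_id.
  by split=> [|y]; [apply: sep_embedding_opp|exists (- y); rewrite opprK].
exists (lift (rinv h) \o n \o (fun x => x + - c)); split.
- apply: (sep_aut_comp (sep_aut_comp _ nA) (sep_aut_shift _)).
  exact/sep_aut_lift/aut_rinv.
- by move=> x; rewrite /= /std addrK /n; case: (e); rewrite ?opprK lift_rinvK.
- by move=> x; rewrite /= /std lift_rinvVK // /n; case: (e); rewrite ?opprK subrK.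
Qed.

Lemma sep_aut_dense f (E : seq rat) : sep_embedding f ->
  exists2 g, sep_aut g & {in E, g =1 f}.
Proof.
move=> /sep_embedding_stdE[c [e [h [hm ->]]]].
(* If [0] is in [E], the junk value [beta' 0] adds one more pair of the graph of [h], which does no
   harm. *)
have [||k ka kh] := @aut_extend [seq (beta' x, h (beta' x)) | x <- E].
- by move=> _ _ /mapP[x _ ->] /mapP[y _ ->] /=; rewrite hm.
- by move=> _ _ /mapP[x _ ->] /mapP[y _ ->] /= ->.
exists (std c e k); first exact: sep_aut_std.
move=> x xE; rewrite /std (_ : lift k x = lift h x) // /lift; case: eqP => // _.
by congr beta; apply: (kh (_, _)); apply: (map_f (fun x => (beta' x, h (beta' x)))).
Qed.

(** * Orientation preserving automorphisms *)

Definition rot_aut (f : rat -> rat) :=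
  sep_aut f /\ forall x y z, cyc (f x) (f y) (f z) = cyc x y z.

Lemma rot_autE f : rot_aut f -> exists c h, aut h /\ f = std c false h.
Proof.
move=> [/sep_autE[c [[] [h [ha fE]]]] fc]; last by exists c, h.
have := fc 0 (beta 0) (beta 1).
by rewrite fE /std !cycD cycN cyc_lift ?cyc0_beta ?ltr01 ?ltr10 //; apply: aut_lt.
Qed.

Lemma rot_aut_std c h : aut h -> rot_aut (std c false h).
Proof.
by move=> ha; split=> [|x y z]; [apply: sep_aut_std|rewrite /std cycD cyc_lift //; apply: aut_lt].
Qed.

Lemma rot_aut_lift h : aut h -> rot_aut (lift h).
Proof.
by move=> ha; split=> [|x y z]; [apply: sep_aut_lift|rewrite cyc_lift //; apply: aut_lt].
Qed.

Lemma rot_aut_shift c : rot_aut (fun x => x + c).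
Proof. by split=> [|x y z]; [apply: sep_aut_shift|rewrite cycD]. Qed.

Lemma rot_aut_comp f g : rot_aut f -> rot_aut g -> rot_aut (f \o g).
Proof.
by move=> [fa fc] [ga gc]; split=> [|x y z]; [apply: sep_aut_comp|rewrite /= fc gc].
Qed.

Lemma rot_aut_inv f : rot_aut f -> exists g, [/\ rot_aut g, cancel f g & cancel g f].
Proof.
move=> [fa fc]; have [g [ga fg gf]] := sep_aut_inv fa; exists g; split=> //; split=> // x y z.
by rewrite -fc !gf.
Qed.

Lemma sep_aut_cyc f : sep_aut f -> rot_aut f \/
  forall x y z, cyc (f x) (f y) (f z) = cyc x z y.
Proof.
move=> fa; have [c [[] [h [ha ->]]]] := sep_autE fa; [right|left]; last exact: rot_aut_std.
by move=> x y z; rewrite /std cycD cycN cyc_lift //; apply: aut_lt.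
Qed.

Lemma rot_aut_conj r s g : sep_aut r -> cancel r s -> cancel s r -> sep_aut s ->
  rot_aut g -> rot_aut (s \o g \o r).
Proof.
move=> ra rs sr sa [ga gc]; split=> [|x y z]; first exact/sep_aut_comp/ra/sep_aut_comp.
have [[_ rc]|rc] := sep_aut_cyc ra; have [[_ sc]|sc] := sep_aut_cyc sa;
  rewrite /= ?sc ?gc ?rc //.
- by rewrite -[RHS]rc -(sr (r x)) -(sr (r y)) -(sr (r z)) rc sc.
- by rewrite -[in RHS](rs x) -[in RHS](rs y) -[in RHS](rs z) sc rc.
Qed.

(** * Endomorphisms fixing every automorphism *)

Definition lt_sum (x y : rat + rat) : bool :=
  match x, y with
  | inl a, inl b | inr a, inr b => a < b
  | inl _, inr _ => true
  | inr _, inl _ => false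
  end.

Lemma lt_sum_dense_order : dense_order lt_sum.
Proof.
have [irr tr tot de mi ma _] := rat_dense_order; split.
- by case.
- by move=> [y|y] [x|x] [z|z] //=; apply: tr.
- by move=> [x|x] [y|y] //= xy; apply: tot; apply: contra_neq xy => ->.
- move=> [x|x] [y|y] //=.
  + by move=> /de[z]; exists (inl z).
  + by have [z] := ma x; exists (inl z).
  + by move=> /de[z]; exists (inr z).
- by move=> [x|x]; [have [z] := mi x; exists (inl z)|exists (inl 0)].
- by move=> [x|x]; [exists (inr 0)|have [z] := ma x; exists (inr z)].
- by exists (inl 0).
Qed.

Lemma aut_shift c : aut (fun x => x + c).
Proof. by split=> [x y|y]; [rewrite ltrD2r|exists (y - c); rewrite subrK]. Qed.

(** Two copies of the line, one after the other, form a line again. The image of [e1] is bounded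
    above and that of [e2] below, so each leaves free one side of the cut at [0]; shifting both
    copies gives [g]. *)
Lemma separated_copies : exists e1 e2 g : rat -> rat,
  [/\ {mono e1 : x y / x < y}, {mono e2 : x y / x < y} & forall x y, e1 x < e2 y] /\
  [/\ aut g, forall x, g x != x, g \o e1 = e1 \o (fun x => x + 1) &
    g \o e2 = e2 \o (fun x => x + 1)].
Proof.
have [|f [k [fK kK fm _]]] := @back_and_forth _ _ _ _ [::] lt_sum_dense_order rat_dense_order.
  by [].
pose s (x : rat + rat) : rat + rat := match x with inl a => inl (a + 1) | inr a => inr (a + 1) end.
exists (f \o inl), (f \o inr), (f \o s \o k); split; split.
- by move=> x y; rewrite /= fm.
- by move=> x y; rewrite /= fm.
- by move=> x y; rewrite /= fm.
- split=> [x y|y] /=.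
    by rewrite fm -[x]kK -[y]kK fm !fK; case: (k x) (k y) => [a|a] [b|b] //=; rewrite ltrD2r.
  pose s' (x : rat + rat) : rat + rat := match x with inl a => inl (a - 1) | inr a => inr (a - 1) end.
  by exists (f (s' (k y))); rewrite fK -[RHS]kK; case: (k y) => a /=; rewrite subrK.
- move=> x; rewrite -[X in _ != X]kK /= (inj_eq (can_inj fK)).
  by case: (k x) => a /=; apply/eqP => -[]; lra.
- by apply/funext => x; rewrite /= fK.
- by apply/funext => x; rewrite /= fK.
Qed.

(* Let [e] embed the circle cut at [0] so that its image avoids a neighbourhood
   of [0] on one side and [lift g \o e = e \o lift s] with [0] the only fixed
   point of [lift g]; then [xi e 0 = 0].  A [lift g'] fixing the image of
   [f \o e] fixes [xi f 0], which determines the latter. *)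
Theorem endomorphism_id (xi : (rat -> rat) -> rat -> rat) :
  (forall f g, sep_embedding f -> sep_embedding g -> xi (f \o g) = xi f \o xi g) ->
  (forall g, sep_aut g -> xi g = g) ->
  forall f, sep_embedding f -> xi f = f.
Proof.
move=> xiM xiG.
have [e1 [e2 [g [[e1m e2m e12] [ga gx ge1 ge2]]]]] := separated_copies.
have xi0 (e : rat -> rat) : {mono e : x y / x < y} -> g \o e = e \o (fun x => x + 1) -> xi (lift e) 0 = 0.
  move=> em ge.
  have eE := sep_embedding_lift em; have gA := sep_aut_lift ga.
  have sA := sep_aut_lift (aut_shift 1).
  have : lift g \o lift e = lift e \o lift (fun x => x + 1) by rewrite -!lift_comp ge.
  move/(congr1 xi); rewrite (xiM _ _ (proj1 gA) eE) (xiM _ _ eE (proj1 sA)).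
  rewrite (xiG _ gA) (xiG _ sA) => /(congr1 (fun f => f 0)) /=; rewrite lift0.
  by case: (betaP (xi _ 0)) => // u; rewrite lift_beta => /beta_inj/eqP; rewrite (negPf (gx u)).
have xiL h : {mono h : x y / x < y} -> xi (lift h) 0 = 0.
  move=> hm; case E: _ / (betaP (xi (lift h) 0)) => [//|u].
  (* If [lift k] fixes the image of [lift (h \o t \o e)], applying [xi] and evaluating at [0] shows
     that it fixes [beta u]; it remains to find such a [k] moving [u]. *)
  have key (e t k : rat -> rat) : {mono e : x y / x < y} -> g \o e = e \o (fun x => x + 1) ->
      aut t -> aut k -> (forall x, k (h (t (e x))) = h (t (e x))) -> k u = u.
    move=> em ge ta ka kh.
    have kE : lift k \o (lift h \o (lift t \o lift e)) = lift h \o (lift t \o lift e).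
      by rewrite -!lift_comp; congr lift; apply/funext => x; apply: kh.
    have tA := sep_aut_lift ta; have kA := sep_aut_lift ka.
    have hE := sep_embedding_lift hm; have eE := sep_embedding_lift em.
    have teE := sep_embedding_comp (proj1 tA) eE; have hteE := sep_embedding_comp hE teE.
    move/(congr1 xi): kE; rewrite (xiM _ _ (proj1 kA) hteE).
    rewrite (xiM _ _ hE teE) (xiM _ _ (proj1 tA) eE) (xiG _ tA) (xiG _ kA).
    move=> /(congr1 (fun f => f 0)) /=; rewrite (xi0 e em ge) lift0 E lift_beta.
    exact: beta_inj.
  have [v vu] : exists v, h v != u.
    have [h0|] := eqVneq (h 0) u; last by exists 0.
    by exists 1; rewrite -h0 (inj_eq (mono_rat_inj hm)) oner_eq0.
  (* With [e1] translated below [v], the image of the composite lies below [h v], where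
     [cut_above (h v) k] is trivial although it moves [u]. The other case is symmetric, with
     [e2]. *)
  exfalso; move: vu; rewrite neq_lt => /orP[hu|uh].
    have [|k ka kP] := @aut_extend_sorted [:: (h v, h v); (u, u + 1)].
      by rewrite /= hu; lra.
    have kv : k (h v) = h v by apply: (kP (_, _)); rewrite mem_head.
    have ku : k u = u + 1 by apply: (kP (u, _)); rewrite !inE eqxx orbT.
    have := key e1 _ (cut_above (h v) k) e1m ge1 (aut_shift (v - e2 0)) (aut_cut_above ka kv).
    rewrite {2}/cut_above (ltW hu) ku => H; suff : u + 1 = u by lra.
    apply: H => x; rewrite /cut_above ifN // -ltNge hm.
    by have := e12 x 0; lra.
  have [|k ka kP] := @aut_extend_sorted [:: (u, u - 1); (h v, h v)].
    by rewrite /= uh; lra.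
  have kv : k (h v) = h v by apply: (kP (_, _)); rewrite !inE eqxx orbT.
  have ku : k u = u - 1 by apply: (kP (u, _)); rewrite !inE eqxx.
  have := key e2 _ (cut_below (h v) k) e2m ge2 (aut_shift (v - e1 0)) (aut_cut_below ka kv).
  rewrite {2}/cut_below uh ku => H; suff : u - 1 = u by lra.
  apply: H => x; rewrite /cut_below ifN // -leNgt ltW // hm.
  by have := e12 0 x; lra.
have xi00 f : sep_embedding f -> xi f 0 = f 0.
  move=> /sep_embedding_stdE[c [e [h [hm ->]]]].
  have aA := sep_aut_std c e aut_id; have hE := sep_embedding_lift hm.
  rewrite (_ : std c e h = std c e id \o lift h); last by apply/funext => x; rewrite /std lift_id.
  by rewrite (xiM _ _ (proj1 aA) hE) (xiG _ aA) /= xiL // lift0.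
move=> f fE; apply/funext => q.
have sA := sep_aut_shift q; have := xi00 _ (sep_embedding_comp fE (proj1 sA)).
by rewrite (xiM _ _ fE (proj1 sA)) (xiG _ sA) /= add0r.
Qed.

(** * Continuity of an action on a countable set *)

Section Action.
Variables (Omega : countType) (act : (rat -> rat) -> Omega -> Omega).
Hypothesis act1 : forall w, act id w = w.
Hypothesis actM : forall f g w, sep_embedding f -> sep_embedding g ->
  act (f \o g) w = act f (act g w).

Lemma act_stabilizer_open w :
  exists F : seq rat, forall g, sep_aut g -> fixes F g -> act g w = w.
Proof.
pose K := [set h | aut h /\ act (lift h) w = w].
have lE h : aut h -> sep_embedding (lift h) by move=> /sep_aut_lift[].
have KV g h : aut g -> aut h -> act (lift g) w = act (lift h) w -> K (rinv g \o h).
  move=> ga ha e; split; first exact/aut_comp/ha/aut_rinv.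
  rewrite lift_comp actM; [|exact/lE/aut_rinv|exact: lE].
  rewrite -e -actM; [|exact/lE/aut_rinv|exact: lE].
  rewrite (_ : lift (rinv g) \o lift g = id) //.
  by apply/funext => x /=; rewrite lift_rinvK.
have sK : small_index K.
  split=> [g []//|g h [ga gw] [ha hw]|g [ga gw]|].
  - by split; [apply: aut_comp|rewrite lift_comp actM ?hw //; apply: lE].
  - by apply: (KV _ _ ga aut_id); rewrite gw lift_id act1.
  - by exists (fun h => pickle (act (lift h) w)) => g h ga ha /(pcan_inj (@pickleK _)); apply: KV.
have [F KF] := small_index_property sK.
(* Fixing [0] makes the translation part trivial, and fixing [beta 0] and [beta 1] as well excludes
   reflections, so that [g] is a [lift]. *)
exists [:: 0, beta 0, beta 1 & map beta F] => g gA gF.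
have g0 : g 0 = 0 by apply: gF; rewrite mem_head.
have [c [e [h [ha gE]]]] := sep_autE gA.
have c0 : c = 0 by move: g0; rewrite gE /std lift0; case: (e); rewrite ?oppr0 add0r.
have rg : rot_aut g.
  have [//|gc] := sep_aut_cyc gA; have := gc 0 (beta 0) (beta 1).
  by rewrite !gF ?inE ?eqxx ?orbT // !cyc0_beta ltr01 ltr10.
have {c0 gE}gE : g = lift h.
  have [c' [h' [ha' gE']]] := rot_autE rg.
  have e0 : e = false.
    case: e gE => // gE; have [_ rc] := rg; have := rc 0 (beta 0) (beta 1).
    by rewrite gE /std !cycD cycN cyc_lift ?cyc0_beta ?ltr01 ?ltr10 //; apply: aut_lt.
  by rewrite gE e0 c0; apply/funext => x; rewrite /std addr0.
have [] // : K h.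
  apply: KF => // x xF; apply: beta_inj; rewrite -lift_beta -gE.
  by apply: gF; rewrite !inE map_f ?orbT.
by rewrite gE.
Qed.

(** Uniform continuity: the quotient of [f] by [g] fixes [F], so one [F] serves all
    automorphisms. *)
Lemma act_aut_support w : exists F : seq rat, forall f g, sep_aut f -> sep_aut g ->
  {in F, f =1 g} -> act f w = act g w.
Proof.
have [F FP] := act_stabilizer_open w; exists F => f g fA gA fg.
have [g' [g'A gg' g'g]] := sep_aut_inv gA.
have -> : f = g \o (g' \o f) by apply/funext => x; rewrite /= g'g.
have gfA := sep_aut_comp g'A fA; rewrite (actM _ (proj1 gA) (proj1 gfA)).
by rewrite FP // => x xF; rewrite /= fg.
Qed.

Hypothesis act_inj : forall f g, sep_embedding f -> sep_embedding g ->
  (forall w, act f w = act g w) -> f = g.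
Hypothesis act_closed : forall p : Omega -> Omega,
  (forall b : seq Omega, exists2 f, sep_embedding f & {in b, act f =1 p}) ->
  exists2 f, sep_embedding f & forall w, act f w = p w.

(* The extension of the action of the automorphisms by uniform continuity is
   [act \o xi] for an endomorphism [xi], which is the identity. *)
Theorem act_support w : exists F : seq rat, forall f g, sep_embedding f -> sep_embedding g ->
  {in F, f =1 g} -> act f w = act g w.
Proof.
have [Fs FsP] := choice act_aut_support.
have /choice[xi xiP] f : exists f', sep_embedding f -> sep_embedding f' /\
    forall w g, sep_aut g -> {in Fs w, g =1 f} -> act f' w = act g w.
  have [fE|] := pselect (sep_embedding f); last by exists f.
  have /choice[p pP] w' : exists w1, forall g, sep_aut g -> {in Fs w', g =1 f} -> w1 = act g w'.
    have [g gA gf] := sep_aut_dense (Fs w') fE; exists (act g w') => g' g'A g'f.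
    by apply: FsP => // x xF; rewrite gf ?g'f.
  have [b|f' f'E f'p] := act_closed (p := p).
    have [g gA gf] := sep_aut_dense (flatten [seq Fs w' | w' <- b]) fE.
    exists g => [|w' wb]; first by case: gA.
    by rewrite (pP w' g) // => x xF; apply/gf/flattenP; exists (Fs w') => //; apply: map_f.
  by exists f' => _; split=> // w' g gA gf; rewrite f'p; apply: pP.
have xiE f : sep_embedding f -> sep_embedding (xi f) by move=> /xiP[].
have xiact f w' g : sep_embedding f -> sep_aut g -> {in Fs w', g =1 f} ->
  act (xi f) w' = act g w' by move=> /xiP[_]; apply.
have xi_id : forall f, sep_embedding f -> xi f = f.
  apply: endomorphism_id => [f g fE gE|g gA]; last first.
    have gE : sep_embedding g by case: gA.
    by apply: act_inj => // [|w']; [apply: xiE|apply: xiact].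
  have fgE := sep_embedding_comp fE gE.
  apply: act_inj => [||w']; [exact: xiE|exact: (sep_embedding_comp (xiE _ fE) (xiE _ gE))|].
  rewrite (actM _ (xiE _ fE) (xiE _ gE)).
  have [g' g'A g'g] := sep_aut_dense (Fs w') gE.
  rewrite (xiact _ _ _ gE g'A g'g).
  (* [f'] must approximate [f] at the point [act g' w'], and on [map g (Fs w')] so that [f' \o g']
     approximates [f \o g]. *)
  have [f' f'A f'f] := sep_aut_dense (Fs (act g' w') ++ map g (Fs w')) fE.
  rewrite (xiact _ _ _ fE f'A) => [|x xF]; last by rewrite f'f // mem_cat xF.
  rewrite -actM; [|by case: f'A|by case: g'A].
  apply: xiact => // [|x xF]; first exact: sep_aut_comp.
  by rewrite /= g'g // f'f // mem_cat map_f ?orbT.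
exists (Fs w) => f g fE gE fg.
have [f' f'A f'f] := sep_aut_dense (Fs w) fE.
rewrite -(xi_id f fE) -(xi_id g gE) !(xiact _ w f') // => x xF.
by rewrite f'f // fg.
Qed.

(** * Minimal supports and continuity of the inverse *)

Lemma aut_move (S : seq rat) x : x \notin S -> exists k, [/\ aut k, fixes S k & k x != x].
Proof.
move=> xS; have [|y [/(_ x (mem_head _ _)) xy yS]] :=
    @seq_between _ _ [:: x] [seq s <- S | x < s] rat_dense_order.
  by move=> a s /[!inE] /eqP-> /[!mem_filter] /andP[].
have ne s : s \in S -> s != x by apply: contraTneq => ->.
have ys s : s \in S -> x < s -> y < s by move=> sS xs; apply: yS; rewrite mem_filter xs.
have [||k ka kP] := @aut_extend ((x, y) :: [seq (s, s) | s <- S]).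
- move=> p q /[!inE] /predU1P[->|/mapP[s sS ->]] /predU1P[->|/mapP[s' sS' ->]] //=.
  + by rewrite !ltxx.
  + exact: ys.
  + by move=> sx; apply: lt_trans sx xy.
- move=> p q /[!inE] /predU1P[->|/mapP[s sS ->]] /predU1P[->|/mapP[s' sS' ->]] //= e.
  + by have := ne _ sS'; rewrite -e eqxx.
  + by have := ne _ sS; rewrite e eqxx.
exists k; split=> // [s sS|].
  by apply: (kP (s, s)); rewrite inE (map_f (fun s => (s, s))) ?orbT.
by have /= -> := kP (x, y) (mem_head _ _); rewrite gt_eqF.
Qed.

(** A [lift] never moves [0], so the cut is placed at [1] by conjugating with a translation; [0]
    then becomes the point [- 1] off the cut. *)
Lemma rot_aut_move (S : seq rat) : 0 \notin S ->
  exists h, [/\ rot_aut h, fixes S h & h 0 != 0].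
Proof.
move=> S0; pose x := beta' (- 1).
have bx : beta x = - 1 by rewrite beta'K.
have [|k [ka kS kx]] := @aut_move [seq beta' (s - 1) | s <- S & s != 1] x.
  apply/mapP => -[s /[!mem_filter] /andP[s1 sS] /(congr1 beta)].
  rewrite bx beta'K ?subr_eq0 // => e.
  by move: S0; rewrite (_ : 0 = s) ?sS //; lra.
exists ((fun y => y + 1) \o lift k \o (fun y => y + - 1)); split.
- by apply: (rot_aut_comp (rot_aut_comp _ _)); [exact: rot_aut_shift|exact: rot_aut_lift|exact: rot_aut_shift].
- move=> s sS /=; have [->|s1] := eqVneq s 1; first by rewrite subrr lift0 add0r.
  rewrite -[s - 1]beta'K ?subr_eq0 // lift_beta kS ?beta'K ?subr_eq0 ?subrK //.
  by apply: map_f; rewrite mem_filter s1.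
rewrite /= add0r -bx lift_beta; apply: contra_neq kx => e.
by apply: beta_inj; rewrite bx; lra.
Qed.

(** [f 0] stays in the arc of [0] between points of [D]; cutting at [0] splits this arc into the
    piece of the line below [D] and the piece above. *)
Lemma rot_aut_side (D : seq rat) f y : rot_aut f -> fixes D f -> f 0 = beta y -> 0 \notin D ->
  {in D, forall d, beta' d != y} /\
  {in D &, forall c d, (y < beta' c) = (y < beta' d)}.
Proof.
move=> [fA fc] fD f0 D0; have ne d : d \in D -> d != 0 by apply: contraTneq => ->.
have yne : {in D, forall d, beta' d != y}.
  move=> d dD; apply/eqP => dy; have [[fI _] _] := fA.
  by have := ne _ dD; rewrite -(inj_eq fI) f0 fD // -dy beta'K ?ne // eqxx.
split=> // c d cD dD; have half a b : a \in D -> b \in D -> y < beta' a -> y < beta' b.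
  move=> aD bD ya; have [//|] := ltP y (beta' b).
  rewrite le_eqVlt (negPf (yne _ bD)) /= => yb.
  have : cyc 0 b a by rewrite -(beta'K (ne _ aD)) -(beta'K (ne _ bD)) cyc0_beta; lra.
  rewrite -fc f0 fD // fD // -(beta'K (ne _ aD)) -(beta'K (ne _ bD)) cyc_beta /cyc; lra.
by apply/idP/idP; apply: half.
Qed.

Lemma act_cancel f g w : sep_aut f -> sep_aut g -> cancel f g -> act g (act f w) = w.
Proof.
move=> [fE _] [gE _] fg; rewrite -actM // (_ : g \o f = id) ?act1 //.
by apply/funext => x; apply: fg.
Qed.

Lemma act_inv_fix f g w : sep_aut f -> sep_aut g -> cancel f g -> act f w = w -> act g w = w.
Proof. by move=> fA gA fg fw; rewrite -{1}fw act_cancel. Qed.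

Definition rot_supports (F : seq rat) w := forall g, rot_aut g -> fixes F g -> act g w = w.

(** Exactly the points that the empty list does not support. *)
Definition rot_moved w := exists2 g, rot_aut g & act g w <> w.

(** Since [h] and its inverse push [0] to opposite sides of [D], one of them brings it to the side
    of [g 0], and a [lift] fixing [D] then takes it to [g 0] exactly. The composite [r] fixes [w],
    and the inverse of [r] after [g] fixes [0] and [D]. *)
Lemma support_shrink D w h : 0 \notin D -> rot_supports (0 :: D) w ->
  rot_aut h -> fixes D h -> act h w = w -> h 0 != 0 -> rot_supports D w.
Proof.
move=> D0 supp hR hD hw h0 g gR gD.
have ne d : d \in D -> d != 0 by apply: contraTneq => ->.
have suppP f : rot_aut f -> fixes D f -> f 0 = 0 -> act f w = w.
  by move=> fR fD f0; apply: supp => // d /[!inE] /predU1P[->|/fD].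
have [g0|g0] := eqVneq (g 0) 0; first exact: suppP.
have [h' [h'R hh' h'h]] := rot_aut_inv hR.
have h'D : fixes D h' by move=> d dD; rewrite -{1}(hD d dD) hh'.
have h'w : act h' w = w by apply: (act_inv_fix (proj1 hR) (proj1 h'R) hh').
have h'0 : h' 0 != 0 by apply: contra_neq h0 => e; rewrite -{1}e h'h.
have hx := beta'K h0; have h'x := beta'K h'0; have gy := beta'K g0.
move: (beta' _) (beta' _) (beta' _) hx h'x gy => y x' x hx h'x gy.
have [xne xs] := rot_aut_side hR hD (esym hx) D0.
have [x'ne x's] := rot_aut_side h'R h'D (esym h'x) D0.
have [yne ys] := rot_aut_side gR gD (esym gy) D0.
have [hz [z [hzR hzD hzw hz0 zy]]] : exists hz z, [/\ rot_aut hz, fixes D hz, act hz w = w,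
    hz 0 = beta z & {in D, forall d, beta' d != z /\ (z < beta' d) = (y < beta' d)}].
  have [D_nil|[d0 d0D]] : D = [::] \/ exists d, d \in D.
    by case: (D) => [|d D']; [left|right; exists d; rewrite mem_head].
    by exists h, x; split=> // d; rewrite D_nil.
  have opp : (x < beta' d0) = (beta' d0 < x').
    have [_ h'c] := h'R.
    rewrite -!cyc0_beta beta'K ?ne // hx h'x -(h'c 0 (h 0) d0) hh' (h'D _ d0D) ?ne //.
    exact: esym (cyc_rot _ _ _).
  have := xne _ d0D; have := x'ne _ d0D; have := yne _ d0D => yd0 x'd0 xd0.
  have [e|e] := eqVneq (x < beta' d0) (y < beta' d0).
    exists h, x; split=> // d dD; split; first exact: xne.
    by rewrite (xs _ _ dD d0D) (ys _ _ dD d0D).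
  exists h', x'; split=> // d dD; split; first exact: x'ne.
  rewrite (x's _ _ dD d0D) (ys _ _ dD d0D).
  move: e opp x'd0; case: (ltgtP x' (beta' d0)) => // _.
    by case: (x < _); case: (y < _).
  by case: (x < _); case: (y < _).
have [||k ka kP] := @aut_extend ((z, y) :: [seq (beta' d, beta' d) | d <- D]).
- move=> p q /[!inE] /predU1P[->|/mapP[d dD ->]] /predU1P[->|/mapP[d' dD' ->]] //=.
  + by rewrite !ltxx.
  + by have [_ ->] := zy _ dD'.
  + have [zd e] := zy _ dD; have := yne _ dD; move: zd e.
    by case: (ltgtP z (beta' d)); case: (ltgtP y (beta' d)).
- move=> p q /[!inE] /predU1P[->|/mapP[d dD ->]] /predU1P[->|/mapP[d' dD' ->]] //= e.
  + by have [+ _] := zy _ dD'; rewrite e eqxx.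
  + by have [+ _] := zy _ dD; rewrite e eqxx.
have kz : k z = y by apply: (kP (z, y)); rewrite mem_head.
have kR := rot_aut_lift ka.
have kD : fixes D (lift k).
  move=> d dD; rewrite -{1}(beta'K (ne _ dD)) lift_beta.
  have -> : k (beta' d) = beta' d.
    by apply: (kP (_, _)); rewrite inE (map_f (fun d => (beta' d, beta' d))) ?orbT.
  by rewrite beta'K ?ne.
have kw : act (lift k) w = w by apply: suppP => //; apply: lift0.
pose r := lift k \o hz; have rR : rot_aut r by apply: rot_aut_comp.
have rw : act r w = w.
  by rewrite actM ?hzw ?kw //; [case: kR => -[]|case: hzR => -[]].
have rD : fixes D r by move=> d dD; rewrite /r /= hzD ?kD.
have [r' [r'R rr' r'r]] := rot_aut_inv rR.
have : act (r' \o g) w = w.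
  apply: suppP => [|d dD|]; first exact: rot_aut_comp.
    by rewrite /= gD // -{1}(rD d dD) rr'.
  by rewrite /= -gy -kz -lift_beta -hz0; apply: rr'.
rewrite actM; [|by case: r'R => -[]|by case: gR => -[]].
by move/(congr1 (act r)); rewrite (act_cancel _ (proj1 r'R) (proj1 rR) r'r) rw.
Qed.

Lemma rot_supports_image t F w : sep_aut t -> rot_supports F w ->
  rot_supports (map t F) (act t w).
Proof.
move=> tA supp g gR gF; have [t' [t'A tt' t't]] := sep_aut_inv tA.
have cR : rot_aut (t' \o g \o t) by apply: rot_aut_conj gR.
have : act (t' \o g \o t) w = w.
  by apply: supp => // x xF; rewrite /= gF ?tt' ?map_f.
rewrite actM; [|by case: (sep_aut_comp t'A (proj1 gR))|by case: tA].
rewrite actM; [|by case: t'A|by case: gR => -[]].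
by move/(congr1 (act t)); rewrite (act_cancel _ t'A tA t't).
Qed.

Lemma rot_moved_image t w : sep_aut t -> rot_moved w -> rot_moved (act t w).
Proof.
move=> tA [g gR gw]; have [t' [t'A tt' t't]] := sep_aut_inv tA.
exists (t \o g \o t'); first exact: rot_aut_conj gR.
rewrite actM; [|by case: (sep_aut_comp tA (proj1 gR))|by case: t'A].
rewrite (act_cancel _ tA t'A tt') actM; [|by case: tA|by case: gR => -[]].
by move/(congr1 (act t')); rewrite !(act_cancel _ tA t'A tt').
Qed.

(** The bound ranges over all moved points, so it survives replacing [w] by an image. *)
Definition minimal_support n := forall F w, rot_moved w -> rot_supports F w -> (n <= size F)%N.

(** [map r F] also supports [w]. If it missed [0], some [h] fixing it and the rest of [F] would move
    [0]; [h] would fix [w], and [support_shrink] would remove [0] from [F]. *)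
Lemma minimal_support0 F w r : minimal_support (size F) -> rot_moved w -> rot_supports F w ->
  0 \in F -> sep_aut r -> act r w = w -> 0 \in map r F.
Proof.
move=> minF mw supp F0 rA rw; apply: contraT => rF0.
pose D := [seq x <- F | x != 0].
have D0 : 0 \notin D by rewrite mem_filter eqxx.
have [|h [hR hS h0]] := @rot_aut_move (map r F ++ D).
  by rewrite mem_cat negb_or rF0.
have hw : act h w = w.
  have := rot_supports_image rA supp; rewrite rw; apply=> // x xF.
  by apply: hS; rewrite mem_cat xF.
have suppD : rot_supports D w.
  apply: (support_shrink D0 _ hR _ hw h0) => [g gR gD|x xD].
    apply: supp => // x xF; have [->|x0] := eqVneq x 0; first by apply: gD; rewrite mem_head.
    by apply: gD; rewrite inE mem_filter x0 xF orbT.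
  by apply: hS; rewrite mem_cat xD orbT.
have := minF _ _ mw suppD; rewrite size_filter leqNgt => /negP; case.
rewrite -(count_predC (fun x => x != 0) F) -[X in (X < _)%N]addn0 ltn_add2l -has_count.
by apply/hasP; exists 0; rewrite //= eqxx.
Qed.

(** A translation brings [a] to [0], where the previous lemma is applied to a conjugate of the
    inverse of [r]. *)
Lemma minimal_support_stable F w r : minimal_support (size F) -> rot_moved w ->
  rot_supports F w -> sep_aut r -> act r w = w -> {in F, forall a, r a \in F}.
Proof.
move=> minF mw supp rA rw a aF.
have [r' [r'A rr' r'r]] := sep_aut_inv rA.
have r'w : act r' w = w by apply: (act_inv_fix rA r'A rr').
pose t x := x + - a; have tA : sep_aut t := sep_aut_shift (- a).
pose t' x := x + a; have t'A : sep_aut t' := sep_aut_shift a.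
have tt' : cancel t t' by move=> x; rewrite /t /t' subrK.
have t't : cancel t' t by move=> x; rewrite /t /t' addrK.
have cA := sep_aut_comp (sep_aut_comp tA r'A) t'A.
have fix0 : act (t \o r' \o t') (act t w) = act t w.
  rewrite actM; [|by case: (sep_aut_comp tA r'A)|by case: t'A].
  by rewrite (act_cancel _ tA t'A tt') actM ?r'w //; [case: tA|case: r'A].
have min' : minimal_support (size (map t F)) by rewrite size_map.
have F0 : 0 \in map t F by apply/mapP; exists a; rewrite // /t subrr.
have := minimal_support0 min' (rot_moved_image tA mw) (rot_supports_image tA supp) F0 cA fix0.
case/mapP => _ /mapP[b bF ->]; rewrite /= tt' /t => /esym/subr0_eq e.
by rewrite -e r'r.
Qed.

(** [w1] has a smallest support through [0], and [w2] is its image under a map that fixes [0] and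
    moves the rest of that support off it. *)
Lemma act_stabilizer_fix0 : exists w1 w2, forall r, sep_aut r ->
  act r w1 = w1 -> act r w2 = w2 -> r 0 = 0.
Proof.
have [w mw] : exists w, rot_moved w.
  apply: contrapT => /forallNP N.
  suff e : (fun x : rat => x + 1) = id by have := congr1 (fun f => f 0) e; rewrite /=; lra.
  apply: act_inj => [||w]; [exact: sep_embedding_shift|exact: sep_embedding_id|].
  apply: contrapT; rewrite act1 => h; apply: (N w).
  by exists (fun x => x + 1) => //; apply: rot_aut_shift.
have ex : exists n, `[< exists F w, [/\ size F = n, rot_moved w & rot_supports F w] >].
  have [F FP] := act_stabilizer_open w; exists (size F); apply/asboolP; exists F, w; split=> //.
  by move=> g [gA _]; apply: FP.
case: (ex_minnP ex) => n /asboolP[F [{mw}w0 [sF mw0 supp0]]] nmin.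
have minF : minimal_support n.
  by move=> F' w' mw' supp'; apply: nmin; apply/asboolP; exists F', w'.
have [a aF] : exists a, a \in F.
  case: (F) supp0 => [|a F'] supp0; last by exists a; rewrite mem_head.
  by have [g gR] := mw0; rewrite supp0.
pose t x := x + - a; have tA : sep_aut t := sep_aut_shift (- a).
have mw1 := rot_moved_image tA mw0; have supp1 := rot_supports_image tA supp0.
have F10 : 0 \in map t F by apply/mapP; exists a; rewrite // /t subrr.
have sF1 : size (map t F) = n by rewrite size_map.
move: (map t F) (act t w0) sF1 mw1 supp1 F10 => F1 w1 sF1 mw1 supp1 F10.
(* [N] exceeds all differences of coordinates, so the translation by [N] of the cut circle sends no
   nonzero point of [F1] into [F1]. *)
have [|N [NP _]] := @seq_between _ _ [seq beta' c - beta' b | c <- F1, b <- F1] [::] rat_dense_order.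
  by [].
have gA := sep_aut_lift (aut_shift N); set g := lift _ in gA.
exists w1, (act g w1) => r rA rw1 rw2.
have rF1 : r 0 \in F1.
  by apply: minimal_support_stable supp1 rA rw1 _ F10; rewrite // sF1.
have : r 0 \in map g F1.
  apply: (minimal_support_stable _ (rot_moved_image gA mw1) (rot_supports_image gA supp1) rA rw2).
    by rewrite size_map sF1.
  by apply/mapP; exists 0; rewrite // /g lift0.
case/mapP => b bF; have [->|b0] := eqVneq b 0; first by rewrite /g lift0.
rewrite -(beta'K b0) /g lift_beta => rE.
have : beta' (r 0) - beta' b < N by apply: NP; apply: allpairs_f.
by rewrite rE betaK; lra.
Qed.

(** By [act_support], [f] and [g] may be replaced by automorphisms without changing their values at
    [q] and at the two points. The quotient of these, moved from [q] to [0], fixes [w1] and [w2],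
    hence [0]. *)
Theorem act_separates q : exists b : seq Omega, forall f g, sep_embedding f -> sep_embedding g ->
  {in b, act f =1 act g} -> f q = g q.
Proof.
have [w1 [w2 wP]] := act_stabilizer_fix0.
pose t x := x + q; have tA : sep_aut t := sep_aut_shift q.
have [t' [t'A tt' t't]] := sep_aut_inv tA.
have [F1 F1P] := act_support (act t w1); have [F2 F2P] := act_support (act t w2).
exists [:: act t w1; act t w2] => f g fE gE fg.
have approx k : sep_embedding k -> exists2 k', sep_aut k' &
    [/\ k' q = k q, act k' (act t w1) = act k (act t w1) & act k' (act t w2) = act k (act t w2)].
  move=> kE; have [k' k'A k'k] := sep_aut_dense (q :: F1 ++ F2) kE.
  have k'E := proj1 k'A; exists k' => //; split; first by apply: k'k; rewrite mem_head.
    by apply: F1P => // x xF; apply: k'k; rewrite inE mem_cat xF orbT.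
  by apply: F2P => // x xF; apply: k'k; rewrite inE mem_cat xF !orbT.
have [f' f'A [f'q f1 f2]] := approx f fE; have [g' g'A [g'q g1 g2]] := approx g gE.
have [k [kA f'k kf']] := sep_aut_inv f'A.
pose r := t' \o (k \o (g' \o t)).
have gtA := sep_aut_comp g'A tA; have kgA := sep_aut_comp kA gtA.
have rA : sep_aut r := sep_aut_comp t'A kgA.
have rE w : act r w = act t' (act k (act g' (act t w))).
  by rewrite /r (actM _ (proj1 t'A) (proj1 kgA)) (actM _ (proj1 kA) (proj1 gtA)) (actM _ (proj1 g'A) (proj1 tA)).
have r0 : r 0 = 0.
  apply: wP => //; rewrite rE.
    rewrite g1 -fg ?mem_head // -f1 (act_cancel _ f'A kA f'k).
    exact: act_cancel.
  rewrite g2 -fg ?inE ?eqxx ?orbT // -f2 (act_cancel _ f'A kA f'k).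
  exact: act_cancel.
move: r0; rewrite /r /= /t add0r => e; rewrite -f'q -g'q.
have {}e : k (g' q) = q by rewrite -[LHS]t't e /t add0r.
by rewrite -{1}e kf'.
Qed.

End Action.

(** * Transfer to the topology of pointwise convergence *)

Lemma nbhs_TrP (X : choiceType) (A : set (Tr X)) (f : A) (V : set A) :
  nbhs f V <-> exists b : seq X, forall g : A,
    {in b, (val g : Tr X) =1 (val f : Tr X)} -> V g.
Proof.
split=> [|[b bV]].
  rewrite nbhsE => -[_ [[U Uo <-] Uf] UV].
  have [b bU] := (open_TrP U).1 Uo _ Uf; exists b => g gb.
  exact/UV/bU.
rewrite nbhsE; exists [set g : A | {in b, (val g : Tr X) =1 (val f : Tr X)}] => //.
split=> //; exists [set g : Tr X | {in b, g =1 (val f : Tr X)}] => //.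
apply/open_TrP => g gb; exists b => h hg x xb.
by rewrite hg // gb.
Qed.

Definition emb (f : rat -> rat) : Emb_Q_sep := insubd (1%g : Emb_Q_sep) (f : Tr rat).

Lemma val_emb f : sep_embedding f -> val (emb f) = f.
Proof. by move=> fE; rewrite /emb insubdK // inE. Qed.

Lemma emb_val (f : Emb_Q_sep) : emb (val f) = f.
Proof. by apply: val_inj; rewrite val_emb //; have := valP f; rewrite inE. Qed.

End Development.

Theorem theorem4p1 (Omega : countType) (M : set (Tr Omega))
    (theta : Emb_Q_sep -> M)
    (M_submonoid : monoid_closed [in M])
    (M_closed : closed M)
    (theta_bij : bijective theta)
    (theta_morph : monoid_morphism (\val \o theta : Emb_Q_sep -> Tr Omega)) :
  homeomorphism theta.
Proof.
pose act f : Omega -> Omega := (val (theta (emb f)) : Tr Omega).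
have act_val x : act (val x) = val (theta x) by rewrite /act emb_val.
have valM (x y : Emb_Q_sep) : val (x * y)%g = Tr_mul (val x) (val y) by rewrite gmulfM.
have val1 : val (1%g : Emb_Q_sep) = @Tr_one rat by rewrite gmulf1.
have embM f g : sep_embedding f -> sep_embedding g -> emb (f \o g) = (emb f * emb g)%g.
  move=> fE gE; apply: val_inj; rewrite val_emb; last exact: sep_embedding_comp.
  by rewrite valM !val_emb.
have act1 w : act id w = w.
  have -> : act id = (\val \o theta) 1%g :> Tr Omega.
    rewrite /act /=; congr (val (theta _)); apply: val_inj.
    by rewrite val1 val_emb //; apply: sep_embedding_id.
  by have [-> _] := theta_morph.
have actM f g w : sep_embedding f -> sep_embedding g -> act (f \o g) w = act f (act g w).
  move=> fE gE; rewrite /act embM //.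
  by have [_ /(_ (emb f) (emb g)) /= ->] := theta_morph.
have act_inj f g : sep_embedding f -> sep_embedding g ->
    (forall w, act f w = act g w) -> f = g.
  move=> fE gE /funext fg; rewrite -(val_emb fE) -(val_emb gE).
  by congr val; apply/(bij_inj theta_bij)/val_inj.
have act_closed (p : Omega -> Omega) :
    (forall b : seq Omega, exists2 f, sep_embedding f & {in b, act f =1 p}) ->
    exists2 f, sep_embedding f & forall w, act f w = p w.
  (* Every cylinder around [p] contains some [theta (emb f)], so [p] is in the closure of [M]. *)
  move=> pb; have Mp : M p.
    apply: contrapT => NMp; have := M_closed; rewrite -openC => /open_TrP/(_ p NMp)[b bM].
    have [f fE fp] := pb b; have := set_valP (theta (emb f)).
    exact: (bM (val (theta (emb f))) fp).
  have [k _ kK] := theta_bij; pose y : M := SigSub (mem_set Mp).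
  exists (val (k y)); first by have := valP (k y); rewrite inE.
  by move=> w; rewrite act_val kK.
have [k thetaK kK] := theta_bij.
have valE (x : Emb_Q_sep) : sep_embedding (val x) by have := valP x; rewrite inE.
split=> [x V /nbhs_TrP[b bV]|].
  have /choice[F FP] := act_support act1 actM act_inj act_closed.
  apply/nbhs_TrP; exists (flatten [seq F w | w <- b]) => y yx; apply: bV => w wb.
  rewrite -!act_val; apply: FP => // q qF; apply: yx.
  by apply/flattenP; exists (F w) => //; apply: map_f.
exists k; split=> // y V /nbhs_TrP[F FV].
have /choice[b bP] := act_separates act1 actM act_inj act_closed.
apply/nbhs_TrP; exists (flatten [seq b q | q <- F]) => z zy; apply: FV => q qF.
apply: (bP q) => // w wb; rewrite !act_val !kK; apply: zy.
by apply/flattenP; exists (b q) => //; apply: map_f.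
Qed.
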